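(* For all fixed integers $k\ge 2$ and $\ell\ge 1$, $$\limsup_{n\to\infty}\mathbf E\left[\left(\frac{\mathcal X_{n,1}}{n^{1-\frac1k}}\right)^{\ell}\right]\le\rho_{k,\ell}:=\frac{\ell!}{\Gamma\left(\ell+1-\frac{\ell}{k}\right)}\left(\frac{\pi\,(k!)^{1/k}}{k\,\sin(\pi/k)}\right)^{\ell}.$$ The upper bound is tight for $\ell=1$, since $\rho_{k,1}=\eta_{k,1}$, where $\eta_{k,1}=\frac{(k!)^{1/k}}{k-1}\Gamma(1/k)$ (and $\mathbf E[\mathcal X_{n,1}]\sim\eta_{k,1}n^{1-1/k}$ as $n\to\infty$).
   Context: Let $(T_{i,j})_{i\ge1,j\ge1}$ be i.i.d. exponential random variables of mean $1$, and let $G_{r,j}=\sum_{i=1}^{r}T_{i,j}$. Consider a path with nodes $1,2,\dots,n$, where $1$ is the root and $n$ is the leaf. For $1\le r\le k$, node $j$ is an $r$-record if $G_{r,j}<\min\{G_{k,i}:1\le i<j\}$ (with $\min\emptyset=+\infty$); $I_{r,j}\in\{0,1\}$ is the indicator of this event. $\mathcal X_{n,1}=\sum_{j=1}^{n}I_{1,j}$ is the number of one-records. $\Gamma$ is the gamma function. *)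

(* Defs.v *)
From HB Require Import structures.
From mathcomp Require Import all_boot all_order all_algebra finmap.
From mathcomp Require Import all_classical all_reals all_analysis.

Set Implicit Arguments.
Unset Strict Implicit.
Unset Printing Implicit Defensive.

Import Order.TTheory GRing.Theory Num.Theory.
Import numFieldNormedType.Exports.

Local Open Scope classical_set_scope.
Local Open Scope ring_scope.

Section Independence.
Context {d : measure_display} {Omega : measurableType d} {R : realType}.
Variable P : probability Omega R.

(** Mutual independence of the subfamily of [X] indexed by [D]: the product
    rule for every finite set of indices taken in [D]. *)
Definition mutually_independent (I : choiceType) (D : set I)
    (X : I -> {RV P >-> R}) : Prop :=
  forall (J : {fset I}) (B : I -> set R),
    [set` J] `<=` D -> (forall i, measurable (B i)) ->
    P (\bigcap_(i in [set` J]) (X i @^-1` B i)) =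
    (\prod_(i <- J) P (X i @^-1` B i))%E.

(** Indices start at 1: the values [T 0 _] and [T _ 0] are unconstrained and
    never used. [exponential_prob] takes the rate, here 1 (mean 1). *)
Definition iid_exp1 (T : nat -> nat -> {RV P >-> R}) : Prop :=
  (forall i j, (1 <= i)%N -> (1 <= j)%N ->
     forall A : set R, measurable A ->
       distribution P (T i j) A = exponential_prob 1 A) /\
  mutually_independent [set p : nat * nat | (1 <= p.1)%N /\ (1 <= p.2)%N]
    (fun p => T p.1 p.2).

End Independence.

Section Records.
Context {Omega : Type} {R : realType}.
Variable T : nat -> nat -> Omega -> R.

Definition Gsum (r j : nat) (w : Omega) : R := \sum_(1 <= i < r.+1) T i j w.

(** The minimum is taken in the extended reals, so that it is [+oo] when
    [j = 1]. *)
Definition is_record (k r j : nat) (w : Omega) : bool :=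
  ((Gsum r j w)%:E < \big[Order.min/+oo]_(1 <= i < j) (Gsum k i w)%:E)%E.

Definition record_indicator (k r j : nat) (w : Omega) : R :=
  (is_record k r j w)%:R.

Definition one_records (k n : nat) (w : Omega) : R :=
  \sum_(1 <= j < n.+1) record_indicator k 1 j w.

End Records.

Definition one_records_moment {d : measure_display} {Omega : measurableType d}
    {R : realType} (P : probability Omega R) (T : nat -> nat -> {RV P >-> R})
    (k l n : nat) : \bar R :=
  ('E_P[fun w => ((one_records T k n w / n%:R `^ (1 - 1 / k%:R)) ^+ l)%R])%E.

Section Constants.
Context {R : realType}.

(** Euler's integral; it is the Gamma function only for [0 < a]. *)
Definition Gamma (a : R) : R :=
  \int[lebesgue_measure]_(x in `]0, +oo[) (x `^ (a - 1) * expR (- x)).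

Definition rho (k l : nat) : R :=
  l`!%:R / Gamma (l%:R + 1 - l%:R / k%:R) *
  (pi * k`!%:R `^ (1 / k%:R) / (k%:R * sin (pi / k%:R))) ^+ l.

Definition eta1 (k : nat) : R :=
  k`!%:R `^ (1 / k%:R) / (k%:R - 1) * Gamma (1 / k%:R).

End Constants.

(* Main.v *)
(** Let p(g) be the probability that T_{1,j} beats g - 1 given columns: it is the
integral over t > 0 of e^-t P(G_k > t)^(g-1), and since P(G_k <= t) is squeezed
between e^-t t^k/k! and t^k/k!, it is governed by the integrals of
(1 - c t^k)^(g-1), which are explicit products.  If j is a one-record and i < j,
then in particular T_{1,j} beats the columns strictly between i and j, and these
events for the successive gaps of j_1 <= ... <= j_l involve disjoint sets of
columns.  Hence E[X^l] / l! is at most the sum over weakly increasing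
j_1 <= ... <= j_l <= n of the product of p over the gaps, with p(0) = 1.

With a = 1 - 1/k, p(g) is compared with the coefficient of z^g in (1 - z)^-a:
for these coefficients convolution is exact (the exponents add up), the ratio
tends to pi (k!)^(1/k) / (k sin(pi/k)) by Euler's sine product, and Gauss' limit
formula turns the final coefficient of (1 - z)^-(l a + 1) into
n^(l a) / Gamma(l a + 1).  For l = 1 no inequality is lost. *)

Require Import Defs.
From HB Require Import structures.
From mathcomp Require Import all_boot all_order all_algebra finmap.
From mathcomp Require Import ring lra zify.
From mathcomp Require Import all_classical all_reals all_analysis.
From mathcomp Require Import measurable_realfun.

Set Implicit Arguments.
Unset Strict Implicit.
Unset Printing Implicit Defensive.

Import Order.TTheory GRing.Theory Num.Theory.
Import numFieldNormedType.Exports.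

Local Open Scope classical_set_scope.
Local Open Scope ring_scope.

(** * Coefficients of (1 - z)^-al *)

(** The product formula for the integrals gives p(g) as a constant over a coefficient of exponent 1
    + 1/k, and reciprocals do not convolve. The identity [nbin_reflect] turns this reciprocal into a
    coefficient of exponent a = 1 - 1/k, at the price of a partial sine product; this is where the
    sine in the constant comes from. Only the limit of the ratio between p and these coefficients is
    known, which says nothing about small gaps. Each comparison therefore carries a relative error e
    and a multiple of a coefficient of smaller exponent (a / 2 is a convenient choice), which
    convolution keeps of lower order; e tends to 0 only at the very end. Loss occurs where a record
    is only required to beat the columns after the preceding chosen one. The leftmost chosen record
    keeps its full condition, so a single index loses nothing. Independence is assumed as a product
    rule for finitely many variables, but it is used between a function of the columns up to i and
    an event in the columns from i + 1 to j. This is why sigma-algebras generated by blocks of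
    variables are set up. *)

(** The coefficient of z^n in (1 - z)^-al, that is, C(al + n - 1, n). *)
Definition nbin {R : realType} (al : R) (n : nat) : R :=
  \prod_(i < n) ((al + i%:R) / i.+1%:R).

Section Nbin.
Context {R : realType}.
Implicit Types al be : R.

Lemma nbin0 al : nbin al 0 = 1.
Proof. by rewrite /nbin big_ord0. Qed.

Lemma nbinS al n : nbin al n.+1 = nbin al n * ((al + n%:R) / n.+1%:R).
Proof. by rewrite /nbin big_ord_recr. Qed.

Lemma nbinSM al n : n.+1%:R * nbin al n.+1 = (al + n%:R) * nbin al n.
Proof. rewrite nbinS; field. by rewrite nat1r pnatr_eq0. Qed.

Lemma nbin_gt0 al n : 0 < al -> 0 < nbin al n.
Proof.
by move=> al0; apply: prodr_gt0 => i _; rewrite divr_gt0// ltr_wpDr.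
Qed.

Lemma nbin1 n : nbin 1 n = 1 :> R.
Proof.
rewrite /nbin big1// => i _.
by rewrite addrC natr1 divff// pnatr_eq0.
Qed.

Lemma nbin_le al be n : 0 < al -> al <= be -> nbin al n <= nbin be n.
Proof.
move=> al0 albe; apply: ler_prod => i _; apply/andP; split.
  by rewrite divr_ge0// addr_ge0// ltW.
by rewrite ler_pM2r ?invr_gt0// lerD2r.
Qed.

(** Chu-Vandermonde. In the inductive step the factor [n + 1] is split as [i + (n + 1 - i)] and
    [nbinSM] absorbs each part into its own coefficient; after reindexing, the two weights add up to
    [al + be + n] whatever [i] is. *)
Lemma nbin_conv al be n :
  \sum_(i < n.+1) nbin al i * nbin be (n - i) = nbin (al + be) n.
Proof.
elim: n => [|n IH]; first by rewrite big_ord1 !nbin0 mulr1.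
have n0 : n.+1%:R != 0 :> R by rewrite pnatr_eq0.
apply: (mulfI n0); rewrite nbinSM -IH mulr_sumr.
transitivity (\sum_(i < n.+2) i%:R * nbin al i * nbin be (n.+1 - i) +
    \sum_(i < n.+2) nbin al i * ((n.+1 - i)%:R * nbin be (n.+1 - i))).
  rewrite -big_split /=; apply: eq_bigr => i _.
  by rewrite natrB ?(ltnW (ltn_ord i)) -1?ltnS ?ltn_ord//; ring.
rewrite big_ord_recl/= !mul0r add0r [X in _ + X]big_ord_recr/= subnn mul0r mulr0.
rewrite addr0 -big_split mulr_sumr /=; apply: eq_bigr => i _.
rewrite nbinSM subSS subSn -1?ltnS// nbinSM natrB -1?ltnS//; ring.
Qed.

Lemma nbin_sum al n : \sum_(i < n.+1) nbin al i = nbin (al + 1) n.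
Proof.
by rewrite -nbin_conv; apply: eq_bigr => i _; rewrite nbin1 mulr1.
Qed.

(** The factors pair up as [(i + 1 - al) (i + 1 + al) / (i + 1)^2], which gives the partial products
    of Euler's formula. *)
Lemma nbin_reflect al n : nbin (1 - al) n * nbin (1 + al) n =
  \prod_(i < n) (1 - al ^+ 2 / i.+1%:R ^+ 2).
Proof.
rewrite /nbin -big_split; apply: eq_bigr => i _ /=.
field. by rewrite nat1r pnatr_eq0.
Qed.

End Nbin.

(** * Euler's sine product *)

Section Calculus.
Context {R : realType}.
Notation mu := (@lebesgue_measure R).
Implicit Types (F f g : R -> R) (a b : R).

Lemma continuous_integrable f a b : continuous f ->
  mu.-integrable `[a, b] (EFin \o f).
Proof.
move=> cf; apply: continuous_compact_integrable; first exact: segment_compact.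
exact: continuous_subspaceT.
Qed.

Lemma Rintegral_derive F f a b : a <= b -> continuous f ->
  (forall x : R, is_derive x (1 : R) F (f x)) ->
  \int[mu]_(x in `[a, b]) f x = F b - F a.
Proof.
rewrite le_eqVlt => /predU1P[<- _ _|ab cf dF].
  by rewrite set_itv1 Rintegral_set1 subrr.
have cF : continuous F.
  move=> x; apply/differentiable_continuous/derivable1_diffP.
  exact: ex_derive.
rewrite /Rintegral (@continuous_FTC2 _ f F a b)//.
- exact: continuous_subspaceT.
- split.
  + by move=> x _; exact: ex_derive.
  + exact/cvg_at_right_filter/cF.
  + exact/cvg_at_left_filter/cF.
- by move=> x _; rewrite derive1E derive_val.
Qed.

Lemma derive_ge0_le F f a b : a <= b -> continuous f ->
  (forall x : R, is_derive x (1 : R) F (f x)) -> (forall x, a <= x <= b -> 0 <= f x) ->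
  F a <= F b.
Proof.
move=> ab cf dF f0; rewrite -subr_ge0 -(Rintegral_derive ab cf dF).
by apply: Rintegral_ge0 => x /=; rewrite in_itv/=; exact: f0.
Qed.

Lemma sin_le_id (x : R) : 0 <= x -> sin x <= x.
Proof.
move=> x0; rewrite -subr_ge0.
have -> : 0 = 0 - sin 0 :> R by rewrite sin0 subr0.
apply: (@derive_ge0_le (fun x => x - sin x) (fun x => 1 - cos x)) => //.
  by move=> y; apply: cvgB; [exact: cvg_cst|exact: continuous_cos].
Qed.

Lemma cos_ge_quadratic (x : R) : 0 <= x -> 1 - x ^+ 2 / 2 <= cos x.
Proof.
move=> x0; rewrite -subr_ge0.
have -> : 0 = cos 0 - (1 - 0 ^+ 2 / 2) :> R by rewrite cos0; ring.
apply: (@derive_ge0_le (fun x => cos x - (1 - x ^+ 2 / 2))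
  (fun x => x - sin x)) => //.
- by move=> y; apply: cvgB; [exact: cvg_id|exact: continuous_sin].
- move=> y; apply: is_derive_eq; rewrite !(scaler0, sub0r, add0r) /=.
  rewrite /GRing.scale/=; lra.
- by move=> y /andP[y0 _]; rewrite subr_ge0 sin_le_id.
Qed.

(** This is [x <= tan x] with the denominator cleared; the difference of the two sides has
    derivative [x sin x]. It serves to bound [t^2 cos^2 t] by [1 - cos^2 t] in [wallis_sub]. *)
Lemma mul_cos_le_sin (x : R) : 0 <= x <= pi / 2 -> x * cos x <= sin x.
Proof.
move=> /andP[x0 xpi]; rewrite -subr_ge0.
have -> : 0 = sin 0 - 0 * cos 0 :> R by rewrite sin0 mul0r subr0.
apply: (@derive_ge0_le (fun x => sin x - x * cos x)
  (fun x => x * sin x)) => //.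
- by move=> y; apply: cvgM; [exact: cvg_id|exact: continuous_sin].
- move=> y; apply: is_derive_eq.
  rewrite /GRing.scale/=; lra.
- move=> y /andP[y0 yx]; rewrite mulr_ge0// sin_ge0_pi// y0/=.
  have := @pi_ge0 R; lra.
Qed.

Lemma continuous_cosM (z : R) : continuous (fun t : R => cos (z * t)).
Proof.
move=> t; apply: continuous_comp; last exact: continuous_cos.
exact: mulrl_continuous.
Qed.

Lemma continuous_exprn f n : continuous f -> continuous (fun t => f t ^+ n).
Proof.
move=> cf t; apply: (@continuous_comp _ _ _ f (fun u => u ^+ n)); first exact: cf.
exact: exprn_continuous.
Qed.

Lemma is_derive_exprn f n (x df : R) : is_derive x (1 : R) f df ->
  is_derive x (1 : R) (fun t => f t ^+ n.+1) (n.+1%:R * f x ^+ n * df).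
Proof.
by move=> dfx; have := is_deriveX n.+1 dfx; rewrite exprfctE.
Qed.

(** As functions of z these integrals satisfy a two-term recurrence whose
product form is the partial sine product; the ratio to z = 0 tends to 1 because
cos^(2n) concentrates at 0. *)
Definition wallis (z : R) n : R :=
  \int[mu]_(t in `[0, pi / 2]) (cos (z * t) * cos t ^+ n.*2).

Let pihalf_ge0 : 0 <= pi / 2 :> R.
Proof. by rewrite divr_ge0// pi_ge0. Qed.

Let continuous_wallis z n :
  continuous (fun t : R => cos (z * t) * cos t ^+ n).
Proof.
move=> t; apply: cvgM; first exact: continuous_cosM.
by apply: continuous_exprn; exact: continuous_cos.
Qed.

Let is_derive_cosM (z t : R) :
  is_derive t (1 : R) (fun t => cos (z * t)) (- (z * sin (z * t))).
Proof.
have dz : is_derive t 1 (fun t => z * t) z.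
  by apply: is_derive_eq; rewrite /GRing.scale/=; ring.
rewrite [X in is_derive _ _ _ X](_ : _ = - sin (z * t) * z); last by ring.
exact: (@is_derive1_comp R cos (fun t => z * t) _ _ _ (is_derive_cos _) dz).
Qed.

Let is_derive_sinM (z t : R) :
  is_derive t (1 : R) (fun t => sin (z * t)) (z * cos (z * t)).
Proof.
have dz : is_derive t 1 (fun t => z * t) z.
  by apply: is_derive_eq; rewrite /GRing.scale/=; ring.
rewrite [X in is_derive _ _ _ X](_ : _ = cos (z * t) * z); last by ring.
exact: (@is_derive1_comp R sin (fun t => z * t) _ _ _ (is_derive_sin _) dz).
Qed.

(** Two integrations by parts, done at once by exhibiting an antiderivative that vanishes at both
    ends because [sin 0 = 0] and [cos (pi / 2) = 0]. *)
Lemma wallisS z n :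
  (n.+1.*2%:R * n.*2.+1%:R) * wallis z n =
  (n.+1.*2%:R ^+ 2 - z ^+ 2) * wallis z n.+1.
Proof.
apply/eqP; rewrite -subr_eq0 /wallis -!RintegralZl//; try exact: continuous_integrable.
rewrite -RintegralB//; last 2 first.
- apply: continuous_integrable => t; apply: cvgM; first exact: cvg_cst.
  exact: continuous_wallis.
- apply: continuous_integrable => t; apply: cvgM; first exact: cvg_cst.
  exact: continuous_wallis.
set m := n.*2.
rewrite doubleS -/m.
apply/eqP; apply: etrans; first apply: (@Rintegral_derive
  (fun t => z * (sin (z * t) * cos t ^+ m.+2)
  - m.+2%:R * (cos (z * t) * cos t ^+ m.+1 * sin t))).
- by [].
- move=> t; apply: cvgB; (apply: cvgM; [exact: cvg_cst|exact: continuous_wallis]).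
- move=> t; have := is_derive_cosM z t; have := is_derive_sinM z t => ds dc.
  have dX1 := is_derive_exprn m (is_derive_cos t).
  have dX2 := is_derive_exprn m.+1 (is_derive_cos t).
  apply: is_derive_eq.
  apply/eqP; rewrite -subr_eq0; apply/eqP; rewrite /GRing.scale/=.
  (* The two expressions for the derivative differ by a multiple of the Pythagorean relation. *)
  transitivity (cos (z * t) * m.+2%:R * m.+1%:R * cos t ^+ m *
    (cos t ^+ 2 + sin t ^+ 2 - 1)).
    by rewrite !exprS expr0 -![in LHS]natr1 -[m.+1%:R in RHS]natr1; ring.
  by rewrite cos2Dsin2 subrr mulr0.
- by rewrite /= cos_pihalf sin0 !expr0n/= !(mulr0, mul0r, sin0) !subr0.
Qed.

Lemma wallis00 : wallis 0 0 = pi / 2.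
Proof.
apply: etrans; first apply: (@Rintegral_derive id) => //.
  by move=> t; apply: is_derive_eq; rewrite mul0r cos0 mul1r.
by rewrite subr0.
Qed.

Lemma wallis0 (z : R) : z != 0 -> wallis z 0 = sin (z * (pi / 2)) / z.
Proof.
move=> z0; apply: etrans.
  apply: (@Rintegral_derive (fun t => z^-1 * sin (z * t))) => //.
  move=> t; have := is_derive_sinM z t => ds.
  apply: is_derive_eq; rewrite /GRing.scale/= expr0 mulr1; field.
  exact: z0.
by rewrite /= mulr0 sin0 mulr0 subr0 mulrC.
Qed.

Lemma wallis0S n : wallis 0 n.+1 = wallis 0 n * (n.*2.+1%:R / n.+1.*2%:R).
Proof.
have n1 : n.+1.*2%:R != 0 :> R by rewrite pnatr_eq0.
have := wallisS 0 n.
rewrite expr0n /= subr0 expr2 -!mulrA => /(mulfI n1) e.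
by apply: (mulfI n1); rewrite -e [RHS]mulrCA (mulrC _%:R (_ / _)) divfK// mulrC.
Qed.

Lemma wallis_gt0 n : 0 < wallis 0 n.
Proof.
elim: n => [|n IH]; first by rewrite wallis00 divr_gt0// pi_gt0.
by rewrite wallis0S mulr_gt0// divr_gt0// ltr0n.
Qed.

(** The integrand of the difference is at most [z^2 / 2] times [t^2 cos^2 t cos^(2n) t], hence at
    most [z^2 / 2] times [cos^(2n) t - cos^(2n+2) t]. The latter integrates to a difference of
    consecutive Wallis integrals, so the relative error is of order 1/n. *)
Lemma wallis_sub (z : R) n : 0 <= z ->
  `|wallis 0 n.+1 - wallis z n.+1| <= z ^+ 2 / 2 * (wallis 0 n.+1 / n.*2.+1%:R).
Proof.
move=> z0.
have ci z' m : mu.-integrable `[0, pi / 2]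
    (EFin \o (fun t : R => cos (z' * t) * cos t ^+ m)).
  by apply: continuous_integrable; exact: continuous_wallis.
have -> : wallis 0 n.+1 / n.*2.+1%:R = wallis 0 n - wallis 0 n.+1.
  have n1 : n.*2.+1%:R != 0 :> R by rewrite pnatr_eq0.
  rewrite wallis0S doubleS; field.
  by rewrite nat1r -natrD !pnatr_eq0.
rewrite /wallis -!RintegralB// -RintegralZl//; last first.
  by apply: continuous_integrable => t; apply: cvgB; exact: continuous_wallis.
rewrite ger0_norm; last first.
  apply: Rintegral_ge0 => t /=; rewrite in_itv/= => /andP[t0 tpi].
  rewrite -mulrBl mul0r cos0 mulr_ge0// ?subr_ge0 ?cos_le1//.
  by rewrite exprn_ge0// cos_ge0_pihalf// tpi andbT (le_trans _ t0)// oppr_le0.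
apply: le_Rintegral => //.
- by apply: continuous_integrable => t; apply: cvgB; exact: continuous_wallis.
- apply: continuous_integrable => t; apply: cvgM; first exact: cvg_cst.
  by apply: cvgB; exact: continuous_wallis.
- move=> t /=; rewrite in_itv/= => /andP[t0 tpi].
  have ct0 : 0 <= cos t.
    by rewrite cos_ge0_pihalf// tpi andbT (le_trans _ t0)// oppr_le0.
  rewrite mul0r cos0 !mul1r doubleS !exprS.
  have h1 := cos_ge_quadratic (mulr_ge0 z0 t0).
  have h2 : (t * cos t) ^+ 2 <= sin t ^+ 2.
    rewrite lerXn2r ?nnegrE ?mulr_ge0//.
      by rewrite sin_ge0_pi// t0/=; have := @pi_ge0 R; lra.
    by rewrite mul_cos_le_sin// t0.
  rewrite sin2cos2 in h2.
  have c0 : 0 <= cos t ^+ n.*2 by rewrite exprn_ge0.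
  have h3 : (1 - cos (z * t)) * (cos t * cos t) <= (z * t) ^+ 2 / 2 * (cos t * cos t).
    by rewrite ler_wpM2r ?mulr_ge0//; lra.
  have h4 : z ^+ 2 / 2 * (t * cos t) ^+ 2 <= z ^+ 2 / 2 * (1 - cos t ^+ 2).
    by rewrite ler_wpM2l// divr_ge0// sqr_ge0.
  have h5 : (1 - cos (z * t)) * (cos t * cos t) * cos t ^+ n.*2 <=
      z ^+ 2 / 2 * (1 - cos t ^+ 2) * cos t ^+ n.*2.
    rewrite ler_wpM2r//; apply: le_trans h3 _; apply: le_trans h4.
    by rewrite le_eqVlt; apply/orP; left; apply/eqP; ring.
  by lra.
Qed.

Lemma cvg_wallis_ratio (z : R) : 0 <= z ->
  wallis z n / wallis 0 n @[n --> \oo] --> (1 : R).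
Proof.
move=> z0; rewrite -cvg_shiftS/=.
apply/cvgrPdist_le => e e0; near=> n.
have w0 := wallis_gt0 n.+1.
rewrite -[X in X - _](divff (lt0r_neq0 w0)) -mulrBl normrM normfV (gtr0_norm w0).
rewrite ler_pdivrMr//; apply: le_trans (wallis_sub n z0) _.
rewrite mulrCA mulrC ler_pM2r//.
rewrite ler_pdivrMr// ?ltr0n//.
rewrite -ler_pdivrMl// (le_trans (y := n%:R))//.
  near: n; exact: nbhs_infty_ger.
by rewrite ler_nat -addnn; apply: leq_trans (leq_addr _ _) _.
Unshelve. all: by end_near. Qed.

(** With [z = 2 * x] the factor [1 - z^2 / (2n + 2)^2] of the recurrence is a factor of the sine
    product. The prefactor is the ratio of the two integrals at [n = 0]. *)
Lemma wallis_prod (x : R) n : 0 < x < 1 ->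
  \prod_(i < n) (1 - x ^+ 2 / i.+1%:R ^+ 2) =
  sin (pi * x) / (pi * x) * (wallis (2 * x) n / wallis 0 n)^-1.
Proof.
move=> /andP[x0 x1].
have x2 : 2 * x != 0 by rewrite mulf_neq0// lt0r_neq0.
have w0 m : wallis 0 m != 0 by rewrite lt0r_neq0// wallis_gt0.
have sx : 0 < sin (pi * x).
  by rewrite sin_gt0_pi// mulr_gt0 ?pi_gt0//= gtr_pMr ?pi_gt0.
have pi0 : pi != 0 :> R by rewrite lt0r_neq0 ?pi_gt0.
suff H m : wallis (2 * x) m * \prod_(i < m) (1 - x ^+ 2 / i.+1%:R ^+ 2) =
    sin (pi * x) / (pi * x) * wallis 0 m.
  (* For [x > 1/2] the integrand changes sign, so nonvanishing is read off from [H n], whose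
     right-hand side is nonzero. *)
  have wn0 : wallis (2 * x) n != 0.
    apply/eqP => wn; have := H n; rewrite wn mul0r => /eqP.
    rewrite eq_sym !mulf_eq0 invr_eq0 mulf_eq0 (negPf (w0 n)) (negPf pi0).
    by rewrite !gt_eqF.
  by apply: (mulfI wn0); rewrite H invf_div mulrCA (mulrC (wallis _ _) (_ / _)) divfK.
elim: m => [|m IH].
  rewrite big_ord0 mulr1 wallis0// wallis00.
  rewrite (_ : 2 * x * (pi / 2) = pi * x); last by field.
  clear sx; move: (sin _) => s; move: (@pi R) pi0 => p p0; field.
  by rewrite p0 gt_eqF.
rewrite wallis0S big_ord_recr/= mulrA [RHS]mulrA -IH.
have m0 : m.+1.*2%:R != 0 :> R by rewrite pnatr_eq0.
have := wallisS (2 * x) m.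
have -> : m.+1.*2%:R ^+ 2 - (2 * x) ^+ 2 =
    m.+1.*2%:R ^+ 2 * (1 - x ^+ 2 / m.+1%:R ^+ 2) :> R.
  by rewrite -muln2 natrM; field; rewrite nat1r pnatr_eq0.
move=> e; apply: (mulfI (expf_neq0 2 m0)).
transitivity (m.+1.*2%:R ^+ 2 * (1 - x ^+ 2 / m.+1%:R ^+ 2) * wallis (2 * x) m.+1 *
   \prod_(i < m) (1 - x ^+ 2 / i.+1%:R ^+ 2)); first by ring.
by rewrite -e; field.
Qed.

Lemma sine_product (x : R) : 0 < x < 1 ->
  \prod_(i < n) (1 - x ^+ 2 / i.+1%:R ^+ 2) @[n --> \oo] --> sin (pi * x) / (pi * x).
Proof.
move=> x01; under eq_cvg do rewrite wallis_prod//.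
have x2 : 0 <= 2 * x by lra.
have := cvgM (@cvg_cst _ (sin (pi * x) / (pi * x)) _ \oo _)
  (cvgV (oner_neq0 R) (cvg_wallis_ratio x2)).
by rewrite invr1 mulr1; apply.
Qed.

End Calculus.

(** * The Gamma function *)

Section GammaTheory.
Context {R : realType}.
Notation mu := (@lebesgue_measure R).
Implicit Types a s x t : R.

Lemma integral_expRN : (\int[mu]_(t in `[0%R, +oo[) (expR (- t))%:E = 1)%E.
Proof.
rewrite integral_mkcond -(integral_exponential_pdf (@ltr01 R)).
apply: eq_integral => x _; rewrite restrict_EFin /exponential_pdf/= !patchE.
by case: ifP => // _; rewrite mulN1r mul1r.
Qed.

Lemma measurable_expRN (D : set R) : measurable_fun D (fun t => (expR (- t))%:E).
Proof.
apply/measurable_EFinP; apply: measurable_funTS.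
by apply: measurableT_comp => //; exact: measurable_funN.
Qed.

Definition gamma_pdf a x : R := x `^ (a - 1) * expR (- x).

Lemma gamma_pdf_ge0 a x : 0 <= gamma_pdf a x.
Proof. by rewrite mulr_ge0// ?powR_ge0 ?expR_ge0. Qed.

Lemma measurable_gamma_pdfR a : measurable_fun setT (gamma_pdf a).
Proof.
apply: measurable_funM; first exact: measurable_powR.
by apply: measurableT_comp => //; exact: measurable_funN.
Qed.

Lemma measurable_gamma_pdf a (D : set R) :
  measurable_fun D (fun x => (gamma_pdf a x)%:E).
Proof.
by apply/measurable_EFinP; apply: measurable_funTS; exact: measurable_gamma_pdfR.
Qed.

Definition eGamma a : \bar R := (\int[mu]_(x in `]0%R, +oo[) (gamma_pdf a x)%:E)%E.

Lemma GammaE a : Gamma a = fine (eGamma a). Proof. by []. Qed.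

Lemma is_derive_gamma a x : 0 < x ->
  is_derive x (1 : R) (gamma_pdf (a + 1)) (a * gamma_pdf a x - gamma_pdf (a + 1) x).
Proof.
move=> x0; rewrite /gamma_pdf addrK.
have dp := is_derive1_powR a x0.
have de : is_derive x (1 : R) (fun x => expR (- x)) (- expR (- x)).
  have := @is_derive1_comp R expR -%R x _ _ (is_derive_expR _) (is_deriveNid _ _).
  by rewrite mulrN1.
by apply: is_derive_eq; rewrite /GRing.scale/=; ring.
Qed.

Lemma continuous_gamma_pdf a x : 0 < x -> {for x, continuous (gamma_pdf a)}.
Proof.
move=> x0; apply/differentiable_continuous/derivable1_diffP.
by rewrite -(subrK 1 a); have dg := is_derive_gamma (a - 1) x0; exact: ex_derive.
Qed.

Lemma gamma_pdf_ibp a (u v : R) : 0 < u -> u < v ->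
  (\int[mu]_(x in `[u, v]) (a * gamma_pdf a x)%:E =
   \int[mu]_(x in `[u, v]) (gamma_pdf (a + 1) x)%:E +
   (gamma_pdf (a + 1) v - gamma_pdf (a + 1) u)%:E)%E.
Proof.
move=> u0 uv.
have pos x : x \in `[u, v] -> 0 < x.
  by rewrite in_itv/= => /andP[ux _]; exact: lt_le_trans ux.
have cg b : {within `[u, v], continuous (gamma_pdf b)}.
  apply: continuous_in_subspaceT => x; rewrite inE/= => /pos.
  exact: continuous_gamma_pdf.
have ci (f : R -> R) : {within `[u, v], continuous f} ->
    mu.-integrable `[u, v] (EFin \o f).
  by move=> cf; apply: continuous_compact_integrable => //; exact: segment_compact.
have cag : {within `[u, v], continuous (fun x => a * gamma_pdf a x)}.
  by move=> x; apply: cvgM; [exact: cvg_cst|exact: cg].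
have := @continuous_FTC2 _ (fun x => a * gamma_pdf a x - gamma_pdf (a + 1) x)
  (gamma_pdf (a + 1)) _ _ uv.
rewrite -EFinB => <-.
- under [X in (_ + X)%E]eq_integral do rewrite EFinB.
  rewrite integralB//; [|exact: ci..].
  by rewrite addeC subeK// integrable_fin_num//; exact: ci.
- by move=> x; apply: cvgB; [exact: cag|exact: cg].
- split.
  + move=> x; rewrite in_itv/= => /andP[ux _].
    have dg := is_derive_gamma a (lt_trans u0 ux); exact: ex_derive.
  + by apply: cvg_at_right_filter; exact: continuous_gamma_pdf.
  + by apply: cvg_at_left_filter; apply: continuous_gamma_pdf; exact: lt_trans uv.
- move=> x; rewrite in_itv/= => /andP[ux _]; rewrite derive1E.
  by have dg := is_derive_gamma a (lt_trans u0 ux); exact: derive_val.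
Qed.

Lemma cvg_gamma_pdf_natr a : 0 < a ->
  gamma_pdf (a + 1) n.+1%:R @[n --> \oo] --> (0 : R).
Proof.
(* [N] exceeds [a], so [y^(N+1) / (N+1)! <= e^y] at [y = n + 1] leaves a spare factor [1 / y]. *)
move=> a0; pose N := (Num.truncn a).+1.
apply: (@squeeze_cvgr _ _ _ _ (fun=> 0) (fun n => N.+1`!%:R * n.+1%:R^-1)).
- apply: nearW => n; rewrite gamma_pdf_ge0/= /gamma_pdf addrK.
  rewrite expRN ler_pdivrMr ?expR_gt0//.
  have n1 : 1 <= n.+1%:R :> R by rewrite ler1n.
  apply: (@le_trans _ _ (n.+1%:R `^ N%:R)).
    by rewrite ler_powR// ltW// truncnS_gt.
  rewrite powR_mulrn//.
  have e := @expR_ge1Dxn R n.+1%:R N (ler0n _ _).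
  apply: (@le_trans _ _ (N.+1`!%:R * n.+1%:R^-1 * (n.+1%:R ^+ N.+1 / N.+1`!%:R))).
    rewrite exprS le_eqVlt; apply/orP; left; apply/eqP; field.
    by rewrite !pnatr_eq0 nat1r pnatr_eq0 -lt0n fact_gt0.
  by rewrite ler_wpM2l ?mulr_ge0 ?invr_ge0//; lra.
- exact: cvg_cst.
- rewrite -[X in _ --> X](mulr0 N.+1`!%:R); apply: cvgM; first exact: cvg_cst.
  exact: cvg_harmonic.
Qed.

Lemma cvg_gamma_pdf_invn a : 0 < a ->
  gamma_pdf (a + 1) n.+1%:R^-1 @[n --> \oo] --> (0 : R).
Proof.
move=> a0; apply: (@squeeze_cvgr _ _ _ _ (fun=> 0) (fun n => n.+1%:R^-1 `^ a)).
- apply: nearW => n; rewrite gamma_pdf_ge0/= /gamma_pdf addrK.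
  by rewrite ler_piMr ?powR_ge0// expR_le1 oppr_le0.
- exact: cvg_cst.
- have /cvg_at_rightP := powR_cvg0 a0; apply; split; last exact: cvg_harmonic.
  by move=> n; rewrite invr_gt0.
Qed.

(* The integrations by parts on [1/n, n] are taken to the limit in the extended
reals, so that no finiteness has to be known beforehand. *)
Lemma eGammaD1 a : 0 < a -> eGamma (a + 1) = (a%:E * eGamma a)%E.
Proof.
move=> a0.
(* The [+ 1] keeps the interval nondegenerate at [n = 0], as [gamma_pdf_ibp] requires. *)
pose K (n : nat) : set R := `[n.+1%:R^-1, n.+1%:R + 1]%classic.
have KU : `]0, +oo[%classic = \bigcup_n K n.
  apply/seteqP; split => x.
    rewrite /= in_itv/= andbT => x0.
    exists (Num.truncn (Num.max x x^-1)) => //; rewrite /K/= in_itv/=.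
    have h : Num.max x x^-1 < (Num.truncn (Num.max x x^-1)).+1%:R by exact: truncnS_gt.
    move: h; rewrite gt_max => /andP[h1 h2].
    rewrite invf_ple ?posrE// ltW//=; lra.
  move=> [n _]; rewrite /K/= !in_itv/= andbT => /andP[h _].
  by apply: lt_le_trans h; rewrite invr_gt0.
have ndK : nondecreasing_seq K.
  move=> m n mn; apply/subsetPset; apply: subset_itv; rewrite bnd_simp.
    by rewrite lef_pV2 ?posrE// ler_nat.
  by rewrite lerD2r ler_nat.
have H (f : R -> R) : (forall x, 0 <= f x) -> measurable_fun setT f ->
    (\int[mu]_(x in K n) (f x)%:E @[n --> \oo] -->
     \int[mu]_(x in `]0%R, +oo[) (f x)%:E)%E.
  move=> f0 mf; rewrite KU; apply: ge0_nondecreasing_set_cvg_integral => //.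
  - by move=> i; exact: measurable_itv.
  - by move=> i; apply/measurable_EFinP/measurable_funTS.
  - by move=> i x _; rewrite lee_fin.
have c1 := H (gamma_pdf (a + 1)) (gamma_pdf_ge0 _) (measurable_gamma_pdfR _).
have c2 : (\int[mu]_(x in K n) (a * gamma_pdf a x)%:E @[n --> \oo] -->
    a%:E * eGamma a)%E.
  rewrite /eGamma -ge0_integralZl_EFin ?ltW//.
  - apply: (H (fun x => a * gamma_pdf a x)) => //.
      by move=> x; rewrite mulr_ge0 ?gamma_pdf_ge0// ltW.
    by apply: measurable_funM => //; exact: measurable_gamma_pdfR.
  - by move=> x _; rewrite lee_fin gamma_pdf_ge0.
  - exact: measurable_gamma_pdf.
have c3 : ((\int[mu]_(x in K n) (gamma_pdf (a + 1) x)%:E +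
    (gamma_pdf (a + 1) (n.+1%:R + 1) - gamma_pdf (a + 1) n.+1%:R^-1)%:E)
    @[n --> \oo] --> eGamma (a + 1) + 0%:E)%E.
  apply: cvgeD => //; first by rewrite fin_num_adde_defl.
  apply: cvg_EFin; first exact: nearW.
  rewrite -[X in _ --> X](subrr 0); apply: cvgB; last exact: cvg_gamma_pdf_invn.
  under eq_cvg do rewrite natr1.
  by have := cvg_gamma_pdf_natr a0; rewrite -(cvg_shiftS (fun n => gamma_pdf (a + 1) n.+1%:R)).
rewrite adde0 in c3.
have e : (fun n => \int[mu]_(x in K n) (a * gamma_pdf a x)%:E)%E =
  (fun n => \int[mu]_(x in K n) (gamma_pdf (a + 1) x)%:E +
    (gamma_pdf (a + 1) (n.+1%:R + 1) - gamma_pdf (a + 1) n.+1%:R^-1)%:E)%E.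
  apply/funext => n; apply: gamma_pdf_ibp => //.
  rewrite (@le_lt_trans _ _ 1)// ?invf_le1 ?ler1n//.
  by rewrite ltrDr.
rewrite e in c2.
exact: (cvg_unique _ c3 c2).
Qed.

Lemma eGamma1 : eGamma 1 = 1%E.
Proof.
rewrite /eGamma integral_itv_obnd_cbnd; last exact: measurable_gamma_pdf.
rewrite -integral_expRN; apply: eq_integral => x _.
by rewrite /gamma_pdf subrr powRr0 mul1r.
Qed.

(** Weighted inequality of arithmetic and geometric means for 1 and x. With [L = ln x], the bound
    [1 + y <= e^y] is used at [- s L] and at [(1 - s) L]; with weights [1 - s] and [s] the terms in
    [L] cancel. *)
Lemma powR_le_tangent x s : 0 < x -> 0 <= s <= 1 -> x `^ s <= 1 - s + s * x.
Proof.
move=> x0 /andP[s0 s1]; rewrite -[in leRHS](lnK x0) /powR gt_eqF//.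
set L := ln x.
have h1 := expR_ge1Dx (- (s * L)).
have h2 := expR_ge1Dx ((1 - s) * L).
have e0 := expR_ge0 (s * L).
have h3 : expR (s * L) * (1 - s * L) <= 1.
  by rewrite -[leRHS](expRxMexpNx_1 (s * L)) ler_wpM2l//; lra.
have h4 : expR (s * L) * (1 + (1 - s) * L) <= expR L.
  rewrite [leRHS](_ : _ = expR (s * L) * expR ((1 - s) * L)).
    by rewrite ler_wpM2l//; lra.
  by rewrite -expRD; congr expR; ring.
have h5 : (1 - s) * (expR (s * L) * (1 - s * L)) <= (1 - s) * 1.
  by rewrite ler_wpM2l// subr_ge0.
have h6 : s * (expR (s * L) * (1 + (1 - s) * L)) <= s * expR L.
  by rewrite ler_wpM2l.
lra.
Qed.

(** The tangent bound is applied to [(x / a)^s] and integrated. Scaling by [a] is what makes the two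
    resulting terms recombine through [eGammaD1] with total weight [(1 - s) + s = 1]. This replaces
    Hoelder's inequality. *)
Lemma eGammaD_le a s : 0 < a -> 0 <= s <= 1 ->
  (eGamma (a + s) <= (a `^ s)%:E * eGamma a)%E.
Proof.
move=> a0 s01; have /andP[s0 s1] := s01.
have -> : ((a `^ s)%:E * eGamma a =
    (a `^ s * (1 - s))%:E * eGamma a + (a `^ s * s / a)%:E * eGamma (a + 1))%E.
  rewrite eGammaD1// muleA -EFinM divfK ?lt0r_neq0// -ge0_muleDl.
  - by rewrite -EFinD -mulrDr subrK mulr1.
  - by rewrite lee_fin mulr_ge0 ?powR_ge0// subr_ge0.
  - by rewrite lee_fin mulr_ge0 ?powR_ge0.
rewrite /eGamma -!ge0_integralZl_EFin//; last 6 first.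
- by move=> x _; rewrite lee_fin gamma_pdf_ge0.
- exact: measurable_gamma_pdf.
- by rewrite mulr_ge0 ?invr_ge0 ?(ltW a0)// mulr_ge0 ?powR_ge0.
- by move=> x _; rewrite lee_fin gamma_pdf_ge0.
- exact: measurable_gamma_pdf.
- by rewrite mulr_ge0 ?powR_ge0// subr_ge0.
rewrite -ge0_integralD//; last 4 first.
- move=> x _; rewrite lee_fin; apply: mulr_ge0; last exact: gamma_pdf_ge0.
  by apply: mulr_ge0; rewrite ?powR_ge0 ?subr_ge0.
- by apply: measurable_funeM; exact: measurable_gamma_pdf.
- move=> x _; rewrite lee_fin; apply: mulr_ge0; last exact: gamma_pdf_ge0.
  by apply: mulr_ge0; rewrite ?invr_ge0 ?(ltW a0)// mulr_ge0 ?powR_ge0.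
- by apply: measurable_funeM; exact: measurable_gamma_pdf.
apply: ge0_le_integral => //.
- by move=> x _; rewrite lee_fin gamma_pdf_ge0.
- exact: measurable_gamma_pdf.
- by apply: emeasurable_funD; apply: measurable_funeM; exact: measurable_gamma_pdf.
move=> x; rewrite /= in_itv/= andbT => x0; rewrite lee_fin.
rewrite /gamma_pdf !mulrA -mulrDl ler_wpM2r ?expR_ge0//.
have -> : x `^ (a + s - 1) = x `^ (a - 1) * x `^ s.
  rewrite -powRD; first by rewrite addrAC.
  by rewrite (gt_eqF x0) implybT.
have -> : x `^ (a + 1 - 1) = x `^ (a - 1) * x.
  by rewrite addrK mulrC mulr_powRB1// ltW.
have -> : x `^ s = a `^ s * (x / a) `^ s.
  by rewrite -powRM ?divr_ge0 1?ltW// mulrC divfK// gt_eqF.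
have := powR_le_tangent (divr_gt0 x0 a0) s01.
move=> h.
have h' : x `^ (a - 1) * a `^ s * ((x / a) `^ s) <=
    x `^ (a - 1) * a `^ s * (1 - s + s * (x / a)).
  by rewrite ler_wpM2l// mulr_ge0 ?powR_ge0.
by rewrite mulrA; apply: le_trans h' _; rewrite le_eqVlt; apply/orP; left; apply/eqP; ring.
Qed.

(** The functional equation carries the property up and down by 1, which reduces it to the argument
    [a + 1] with [0 < a <= 1]. There [eGammaD_le] bounds the integral on both sides through the
    known values at 1 and 2, both equal to 1. *)
Lemma eGamma_fin_gt0 a : 0 < a -> eGamma a \is a fin_num /\ (0 < eGamma a)%E.
Proof.
pose Q b := eGamma b \is a fin_num /\ (0 < eGamma b)%E.
have g0 b : (0 <= eGamma b)%E.
  by apply: integral_ge0 => x _; rewrite lee_fin gamma_pdf_ge0.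
have up b : 0 < b -> Q b -> Q (b + 1).
  rewrite /Q => b0; rewrite eGammaD1//.
  case: (eGamma b) (g0 b) => [r _|_ []|_ []] //.
  by rewrite -EFinM !lte_fin => -[_ r0]; split => //; rewrite mulr_gt0.
have down b : 0 < b -> Q (b + 1) -> Q b.
  rewrite /Q => b0; rewrite eGammaD1//.
  case: (eGamma b) (g0 b) => [r _ [_]|_ []|//].
    by rewrite -EFinM !lte_fin pmulr_rgt0//; split.
  by rewrite gt0_muley ?lte_fin.
suff H N : a <= N%:R + 1 -> 0 < a -> Q a.
  move=> a0; apply: (H (Num.truncn a)) => //.
  by rewrite natr1 ltW// truncnS_gt.
elim: N a => [|N IH] a aN a0; last first.
  have [a1|a1] := leP a 1; first by apply: IH => //; rewrite (le_trans a1)// lerDr.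
  rewrite -(subrK 1 a); apply: up; first by rewrite subr_gt0.
  by apply: IH; [move: aN; rewrite -natr1; lra|rewrite subr_gt0].
apply: down => //.
have a1 : a <= 1 by rewrite add0r in aN.
have le1 : (eGamma (a + 1) <= 1)%E.
  have := @eGammaD_le 1 a ltr01.
  by rewrite (ltW a0) a1 powR1 eGamma1 mule1 addrC; apply.
have a1gt0 : 0 < a + 1 by rewrite addr_gt0.
have lo : (1 <= ((a + 1) `^ (1 - a))%:E * eGamma (a + 1))%E.
  have := @eGammaD_le (a + 1) (1 - a) a1gt0.
  rewrite (_ : a + 1 + (1 - a) = 1 + 1); last by ring.
  by rewrite (@eGammaD1 1)// eGamma1 mule1; apply; apply/andP; split; lra.
rewrite /Q; case: (eGamma (a + 1)) le1 lo => [r _|//|_].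
  rewrite -EFinM lee_fin lte_fin => h; split => //.
  by have := lt_le_trans ltr01 h; rewrite pmulr_rgt0// powR_gt0.
by rewrite gt0_muleNy// lte_fin powR_gt0.
Qed.
End GammaTheory.

(* Only the functional equation and half of log-convexity are needed. *)
Section GaussLimit.
Context {R : realType} (G : R -> R).
Hypotheses (G1 : G 1 = 1) (G_gt0 : forall a, 0 < a -> 0 < G a)
  (GD1 : forall a, 0 < a -> G (a + 1) = a * G a)
  (GD_le : forall a s, 0 < a -> 0 <= s <= 1 -> G (a + s) <= a `^ s * G a).
Implicit Types a : R.

Lemma gauss_natr n : G n.+1%:R = n`!%:R :> R.
Proof.
elim: n => [|n IH]; first by rewrite G1 fact0.
by rewrite -natr1 GD1// IH factS natrM.
Qed.

Lemma nbin_gauss a n : 0 < a -> nbin a n = G (a + n%:R) / (G a * n`!%:R).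
Proof.
move=> a0; have g0 : G a != 0 :> R by rewrite lt0r_neq0// G_gt0.
elim: n => [|n IH]; first by rewrite nbin0 addr0 fact0 mulr1 divff.
rewrite nbinS IH -[in RHS]natr1 addrA GD1; last by rewrite ltr_wpDr.
rewrite factS natrM; field.
by rewrite g0 pnatr_eq0 -lt0n fact_gt0 nat1r pnatr_eq0.
Qed.

Lemma nbinD1 a n : 0 < a -> nbin (a + 1) n = nbin a n * ((a + n%:R) / a).
Proof.
move=> a0; have g0 : G a != 0 :> R by rewrite lt0r_neq0// G_gt0.
rewrite !nbin_gauss ?addr_gt0// addrAC !GD1 ?ltr_wpDr//; field.
by rewrite g0 gt_eqF// pnatr_eq0 -lt0n fact_gt0.
Qed.

(** Steps of size 1 reduce to [0 < a <= 1]. With [m = n + 1], the two uses [G (m + a) <= m^a G m]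
    and [m! = G (a + m + (1 - a)) <= (a + m)^(1 - a) G (a + m)] of [GD_le] then squeeze the
    quotient. *)
Lemma cvg_nbin_gauss a : 0 < a ->
  nbin a n / n%:R `^ (a - 1) @[n --> \oo] --> (G a)^-1.
Proof.
move=> a0.
suff H N : a <= N%:R + 1 -> 0 < a ->
    nbin a n.+1 / n.+1%:R `^ (a - 1) @[n --> \oo] --> (G a)^-1.
  rewrite -(cvg_shiftS (fun n => nbin a n / n%:R `^ (a - 1))).
  by apply: (H (Num.truncn a)) => //; rewrite natr1 ltW// truncnS_gt.
have cvgS b : (b + n.+1%:R) / n.+1%:R @[n --> \oo] --> (1 : R).
  have -> : (fun n => (b + n.+1%:R) / n.+1%:R) = (fun n => 1 + b * n.+1%:R^-1).
    by apply/funext => n; field; rewrite nat1r pnatr_eq0.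
  have := cvgD (@cvg_cst _ (1 : R) _ \oo _)
    (cvgM (@cvg_cst _ b _ \oo _) (@cvg_harmonic R)).
  by rewrite mulr0 addr0; apply.
elim: N a {a0} => [|N IH] a aN a0; last first.
  have [a1|a1] := leP a 1; first by apply: IH => //; rewrite (le_trans a1)// lerDr.
  have b0 : 0 < a - 1 by rewrite subr_gt0.
  have {}IH : nbin (a - 1) n.+1 / n.+1%:R `^ (a - 1 - 1) @[n --> \oo] --> (G (a - 1))^-1.
    by apply: IH b0; move: aN; rewrite -natr1; lra.
  have -> : (G a)^-1 = (G (a - 1))^-1 * 1 * (a - 1)^-1.
    by rewrite mulr1 -invfM mulrC -GD1// subrK.
  have -> : (fun n => nbin a n.+1 / n.+1%:R `^ (a - 1)) =
      (fun n => nbin (a - 1) n.+1 / n.+1%:R `^ (a - 1 - 1) *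
        ((a - 1 + n.+1%:R) / n.+1%:R) * (a - 1)^-1).
    apply/funext => n.
    rewrite -[in nbin a _](subrK 1 a) nbinD1//.
    rewrite -[X in _ / X](@mulr_powRB1 _ n.+1%:R)//.
    have p0 : n.+1%:R `^ (a - 1 - 1) != 0 :> R by rewrite gt_eqF ?powR_gt0.
    move: (powR _ _) p0 (nbin _ _) => p p0 q.
    have n0 : n.+1%:R != 0 :> R by rewrite pnatr_eq0.
    move: (n.+1%:R) n0 => r r0; move: (a - 1) b0 => b b0.
    by field; rewrite p0 r0 gt_eqF.
  by apply: cvgM; [exact: cvgM|exact: cvg_cst].
have a1 : a <= 1 by rewrite add0r in aN.
have g0 : 0 < G a :> R by apply: G_gt0.
apply: (@squeeze_cvgr _ _ _ _ (fun n => (G a)^-1 * ((a + n.+1%:R) / n.+1%:R)^-1)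
   (fun=> (G a)^-1)); last 2 first.
- have := cvgM (@cvg_cst _ (G a)^-1 _ \oo _) (cvgV (oner_neq0 R) (cvgS a)).
  by rewrite invr1 mulr1; apply.
- exact: cvg_cst.
apply: nearW => n.
have n0 : 0 < n.+1%:R :> R by rewrite ltr0n.
have gn0 : 0 < G n.+1%:R :> R by rewrite G_gt0.
have fE : n.+1`!%:R = n.+1%:R * G n.+1%:R :> R by rewrite gauss_natr factS natrM.
have up : G (a + n.+1%:R) <= n.+1%:R `^ a * G n.+1%:R.
  by rewrite addrC GD_le// a1 ltW.
have lo : n.+1`!%:R <= (a + n.+1%:R) `^ (1 - a) * G (a + n.+1%:R).
  have := @GD_le (a + n.+1%:R) (1 - a).
  rewrite (_ : a + _ + (1 - a) = n.+2%:R); last by rewrite -[RHS]natr1; ring.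
  by rewrite gauss_natr; apply; [rewrite addr_gt0|apply/andP; split; lra].
have powE : n.+1%:R `^ a = n.+1%:R * n.+1%:R `^ (a - 1) :> R.
  by rewrite mulr_powRB1.
have p0 : 0 < n.+1%:R `^ (a - 1) :> R by rewrite powR_gt0.
rewrite nbin_gauss// fE.
have -> : G (a + n.+1%:R) / (G a * (n.+1%:R * G n.+1%:R)) / n.+1%:R `^ (a - 1)
  = (G a)^-1 * (G (a + n.+1%:R) / (n.+1%:R `^ a * G n.+1%:R)).
  by rewrite powE; field; rewrite nat1r pnatr_eq0 !gt_eqF.
rewrite !ler_pM2l ?invr_gt0// ler_piMr ?invr_ge0 ?(ltW g0)//; last first.
  by rewrite ler_pdivrMr ?mul1r// mulr_gt0// powR_gt0.
rewrite andbT invf_div ler_pdivlMr ?mulr_gt0 ?powR_gt0//.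
rewrite mulrAC ler_pdivrMr ?addr_gt0// mulrCA -fE.
apply: (@le_trans _ _ (n.+1%:R `^ a * ((a + n.+1%:R) `^ (1 - a) * G (a + n.+1%:R)))).
  by rewrite ler_wpM2l ?powR_ge0.
rewrite mulrA [leRHS]mulrC ler_wpM2r//; first by rewrite ltW// G_gt0 ?addr_gt0.
have an0 : 0 < a + n.+1%:R by rewrite addr_gt0.
have -> : (a + n.+1%:R) `^ (1 - a) = (a + n.+1%:R) / (a + n.+1%:R) `^ a.
  by rewrite powRB ?powRr1 ?(ltW an0)// (gt_eqF an0) implybT.
rewrite mulrCA ler_piMr ?(ltW an0)// ler_pdivrMr ?powR_gt0// mul1r.
by rewrite ge0_ler_powR ?nnegrE ?(ltW an0) ?(ltW a0)// lerDr ltW.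
Qed.

End GaussLimit.

Section GammaValues.
Context {R : realType}.
Implicit Types a s x t : R.

Lemma eGamma_EFin a : 0 < a -> eGamma a = (Gamma a)%:E.
Proof. by move=> /eGamma_fin_gt0[f _]; rewrite GammaE fineK. Qed.

Lemma Gamma_gt0 a : 0 < a -> 0 < Gamma a :> R.
Proof.
by move=> a0; have [_] := eGamma_fin_gt0 a0; rewrite eGamma_EFin// lte_fin.
Qed.

Lemma GammaD1 a : 0 < a -> Gamma (a + 1) = a * Gamma a :> R.
Proof.
move=> a0; apply: EFin_inj; rewrite EFinM -!eGamma_EFin ?eGammaD1//.
by rewrite addr_gt0.
Qed.

Lemma Gamma1 : Gamma 1 = 1 :> R.
Proof. by rewrite GammaE eGamma1. Qed.

Lemma GammaD_le a s : 0 < a -> 0 <= s <= 1 ->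
  Gamma (a + s) <= a `^ s * Gamma a.
Proof.
move=> a0 s01; have := eGammaD_le a0 s01; case/andP: s01 => s0 _.
by rewrite !eGamma_EFin// ltr_wpDr.
Qed.

Lemma cvg_nbin a : 0 < a ->
  nbin a n / n%:R `^ (a - 1) @[n --> \oo] --> (Gamma a)^-1.
Proof.
apply: cvg_nbin_gauss.
- exact: Gamma1.
- exact: Gamma_gt0.
- exact: GammaD1.
- exact: GammaD_le.
Qed.

End GammaValues.

(** * The integral of e^-t P(G_k > t)^g *)

Section RecordIntegral.
Context {R : realType}.
Notation mu := (@lebesgue_measure R).

Let continuous_base (c : R) k g : continuous (fun t : R => (1 - c * t ^+ k) ^+ g).
Proof.
apply: continuous_exprn => t; apply: cvgB; first exact: cvg_cst.
by apply: cvgM; [exact: cvg_cst|exact: exprn_continuous].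
Qed.

(** A beta integral in disguise. The function [t (1 - c t^k)^(g+1)] vanishes at 0 and at [s], so its
    derivative integrates to 0; writing [c t^k] as [1 - (1 - c t^k)] there gives a recurrence in
    [g]. *)
Lemma beta_integral (k g : nat) (c s : R) : (0 < k)%N -> 0 <= s -> c * s ^+ k = 1 ->
  \int[mu]_(t in `[0, s]) ((1 - c * t ^+ k) ^+ g) = s / nbin (1 + k%:R^-1) g.
Proof.
case: k => // k _ s0 cs.
elim: g => [|g IH].
  apply: etrans; first apply: (@Rintegral_derive _ id) => //.
  by rewrite nbin0 divr1 /= subr0.
have kn0 : k.+1%:R != 0 :> R by rewrite pnatr_eq0.
have gn0 : g.+1%:R != 0 :> R by rewrite pnatr_eq0.
have kg0 : 1 + g.+1%:R * k.+1%:R != 0 :> R by rewrite -natrM nat1r pnatr_eq0.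
apply: (mulfI kg0); rewrite nbinS.
transitivity (g.+1%:R * k.+1%:R * \int[mu]_(t in `[0, s]) ((1 - c * t ^+ k.+1) ^+ g)); last first.
  rewrite IH; have n0 : nbin (1 + k.+1%:R^-1 : R) g != 0.
    by rewrite gt_eqF// nbin_gt0// addr_gt0// invr_gt0.
  move: (nbin _ _) n0 => b b0.
  move: kg0 gn0; rewrite -natr1; move: k.+1%:R kn0 => r r0 kg0 gn0.
  field; rewrite gn0 r0 b0 andbT/= (_ : r + 1 + _ = 1 + (g%:R + 1) * r)//; ring.
apply/eqP; rewrite -subr_eq0.
rewrite -RintegralZl//; last exact: continuous_integrable.
rewrite -RintegralZl//; last exact: continuous_integrable.
rewrite -RintegralB//; last 2 first.
- apply: continuous_integrable => t; apply: cvgM; first exact: cvg_cst.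
  exact: continuous_base.
- apply: continuous_integrable => t; apply: cvgM; first exact: cvg_cst.
  exact: continuous_base.
apply/eqP; apply: etrans.
  apply: (@Rintegral_derive _ (fun t => t * (1 - c * t ^+ k.+1) ^+ g.+1)) => //.
  - by move=> t; apply: cvgB; (apply: cvgM; [exact: cvg_cst|exact: continuous_base]).
  - move=> t.
    have dt := is_derive_exprn k (is_derive_id t (1 : R)).
    have db : is_derive t (1 : R) (fun t => 1 - c * t ^+ k.+1) (- (c * (k.+1%:R * t ^+ k))).
      by apply: is_derive_eq; rewrite /GRing.scale/=; ring.
    have dX := is_derive_exprn g db.
    apply: is_derive_eq; rewrite /GRing.scale/= !exprS; ring.
by rewrite /= cs subrr expr0n/= mulr0 mul0r subr0.
Qed.

Lemma Rintegral_base_ge0 (k g : nat) (c s : R) : 0 <= c -> 0 <= s -> c * s ^+ k = 1 ->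
  forall t, 0 <= t <= s -> 0 <= (1 - c * t ^+ k) ^+ g.
Proof.
move=> c0 s0 cs t /andP[t0 ts]; rewrite exprn_ge0// subr_ge0 -cs.
by rewrite ler_wpM2l// lerXn2r.
Qed.

(** The coefficient is at most [nbin 2 g = g + 1], while [r <= e^(r - 1)] makes the power
    exponentially small. This removes the part of the integrals away from 0. *)
Lemma cvg_geometric_nbin (r x : R) : 0 <= r < 1 -> 0 <= x <= 1 ->
  r ^+ g * nbin (1 + x) g @[g --> \oo] --> (0 : R).
Proof.
move=> /andP[r0 r1] /andP[x0 x1]; set h : R := 1 - r.
have h0 : 0 < h by rewrite subr_gt0.
have nb g : nbin (1 + x) g <= g.+1%:R.
  apply: (@le_trans _ _ (nbin (1 + 1) g)); first by rewrite nbin_le// ?lerD2l// ltr_pwDl.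
  rewrite -nbin_sum; under eq_bigr do rewrite nbin1.
  by rewrite sumr_const card_ord.
have nb0 g : 0 <= nbin (1 + x) g by rewrite ltW// nbin_gt0// ltr_pwDl.
apply: (@squeeze_cvgr _ _ _ _ (fun=> 0)
    (fun g => 2 * expR h / h ^+ 2 * g.+1%:R^-1)); last 2 first.
- exact: cvg_cst.
- rewrite -[X in _ --> X](mulr0 (2 * expR h / h ^+ 2)).
  by apply: cvgM; [exact: cvg_cst|exact: cvg_harmonic].
apply: nearW => g; rewrite mulr_ge0 ?exprn_ge0//=.
have re : r ^+ g <= expR (- h) ^+ g.
  rewrite lerXn2r ?nnegrE ?expR_ge0//.
  by have := expR_ge1Dx (- h); rewrite /h; lra.
have e1 : expR (- h) ^+ g = expR h * expR (- (h * g.+1%:R)).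
  by rewrite -expRM_natl -expRD; congr expR; rewrite -natr1; ring.
have e2 : expR (- (h * g.+1%:R)) <= 2 / (h * g.+1%:R) ^+ 2.
  have hg : 0 < h * g.+1%:R by rewrite mulr_gt0.
  rewrite expRN -[leRHS]invf_div lef_pV2 ?posrE ?expR_gt0 ?divr_gt0 ?exprn_gt0//.
  by have := expR_ge1Dxn 1 (ltW hg); rewrite (_ : 2`! = 2%N)//; lra.
apply: le_trans (ler_pM _ _ re (nb g)) _; rewrite ?exprn_ge0//.
rewrite e1 [leRHS](_ : _ = expR h * (2 / (h * g.+1%:R) ^+ 2) * g.+1%:R).
  by rewrite ler_wpM2r// ler_wpM2l// expR_ge0.
have g0 : g.+1%:R != 0 :> R by rewrite pnatr_eq0.
by move: (g.+1%:R) g0 => y y0; field; rewrite y0 gt_eqF.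
Qed.

Section Survival.
Context (k : nat) (q : R -> R) (p : nat -> R).
Hypotheses (k0 : (0 < k)%N) (mq : measurable_fun setT q)
  (q_ge0 : forall t, 0 <= q t)
  (q_le : forall s t, s <= t -> q t <= q s)
  (q_lower : forall t, 0 <= t -> 1 - t ^+ k / k`!%:R <= q t)
  (q_upper : forall t, 0 <= t -> q t <= 1 - expR (- t) * t ^+ k / k`!%:R)
  (pE : forall g, (p g.+1)%:E =
    (\int[mu]_(t in `[0%R, +oo[) (expR (- t) * q t ^+ g)%:E)%E).

Let kf0 : 0 < k`!%:R :> R. Proof. by rewrite ltr0n fact_gt0. Qed.

Let mintegrand g (D : set R) : measurable_fun D (fun t => (expR (- t) * q t ^+ g)%:E).
Proof.
apply/measurable_EFinP; apply: measurable_funTS; apply: measurable_funM.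
  by apply: measurableT_comp => //; exact: measurable_funN.
exact: measurable_funX.
Qed.

Let mbase c g (D : set R) : measurable_fun D (fun t => ((1 - c * t ^+ k) ^+ g)%:E).
Proof.
apply/measurable_EFinP; apply: measurable_funTS.
by apply: continuous_measurable_fun; exact: continuous_base.
Qed.

Let integrand_ge0 g t : (0 <= (expR (- t) * q t ^+ g)%:E)%E.
Proof. by rewrite lee_fin mulr_ge0 ?expR_ge0// exprn_ge0. Qed.

Let ebeta (g : nat) (c s : R) : 0 <= s -> c * s ^+ k = 1 ->
  (\int[mu]_(t in `[0%R, s]) ((1 - c * t ^+ k) ^+ g)%:E =
   (s / nbin (1 + k%:R^-1) g)%:E)%E.
Proof.
move=> s0 cs; rewrite -(beta_integral g k0 s0 cs) /Rintegral fineK//.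
by apply: integrable_fin_num => //; exact: continuous_integrable.
Qed.

(** The integral is cut at [d]. Before [d], [e^-t >= e^-d] puts [q] below [1 - c t^k] with a fixed
    [c], and the range may be enlarged to [s], the zero of that base. After [d], [q] is at most its
    bound at [d], and [e^-t] has total mass 1. *)
Lemma record_prob_upper (d s : R) g : 0 <= d -> 0 <= s -> expR (- d) / k`!%:R * s ^+ k = 1 ->
  d <= s ->
  p g.+1 <= s / nbin (1 + k%:R^-1) g + (1 - expR (- d) * d ^+ k / k`!%:R) ^+ g.
Proof.
move=> d0 s0 cs ds; set c := expR (- d) / k`!%:R in cs; set r := 1 - _.
have c0 : 0 <= c by rewrite divr_ge0 ?expR_ge0// ltW.
have r0 : 0 <= r.
  rewrite /r mulrAC -/c subr_ge0 -cs ler_wpM2l//.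
  by rewrite lerXn2r.
pose f1 : R -> R := (fun t => (1 - c * t ^+ k) ^+ g) \_ `[0, s].
have f10 t : 0 <= f1 t.
  rewrite /f1 patchE; case: ifPn => //; rewrite inE/= in_itv/= => ts.
  exact: Rintegral_base_ge0 cs _ _.
have mf1 (D : set R) : measurable_fun D (fun t => (f1 t)%:E).
  apply/measurable_EFinP; apply: measurable_funTS.
  by apply/measurable_restrict => //; apply/measurable_EFinP; exact: mbase.
rewrite -lee_fin pE EFinD.
apply: (@le_trans _ _ (\int[mu]_(t in `[0%R, +oo[) ((f1 t)%:E + (r ^+ g)%:E * (expR (- t))%:E))%E).
  apply: ge0_le_integral => //.
  - exact: mintegrand.
  - by apply: emeasurable_funD; [exact: mf1|apply: measurable_funeM; exact: measurable_expRN].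
  move=> t; rewrite /= in_itv/= andbT => t0.
  rewrite -EFinM -EFinD lee_fin.
  have /orP[td|dt] : (t <= d) || (d < t) by rewrite leNgt orNb.
    rewrite -[leLHS]addr0 lerD//; last by rewrite mulr_ge0 ?expR_ge0// exprn_ge0.
    rewrite /f1 patchE mem_set/=; last by rewrite in_itv/= t0 (le_trans td).
    rewrite -[leRHS]mul1r ler_pM ?expR_ge0 ?exprn_ge0//; first by rewrite expR_le1 oppr_le0.
    rewrite lerXn2r ?nnegrE//.
      have := Rintegral_base_ge0 1 c0 s0 cs (t := t).
      by rewrite expr1; apply; rewrite t0 (le_trans td).
    apply: le_trans (q_upper t0) _.
    rewrite lerD2l lerN2 mulrAC ler_wpM2r ?invr_ge0 ?(ltW kf0)//.
    by rewrite ler_wpM2r ?exprn_ge0// ler_expR lerN2.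
  rewrite -[leLHS]add0r lerD// mulrC ler_wpM2r ?expR_ge0//.
  rewrite lerXn2r ?nnegrE//.
  exact: le_trans (q_le (ltW dt)) (q_upper d0).
rewrite ge0_integralD//; last 2 first.
- by move=> t _; rewrite -EFinM lee_fin mulr_ge0 ?expR_ge0// exprn_ge0.
- by apply: measurable_funeM; exact: measurable_expRN.
rewrite ge0_integralZl_EFin ?exprn_ge0//.
- rewrite integral_expRN mule1 leeD2r// -(ebeta g s0 cs).
  rewrite [leRHS]integral_mkcond.
  under [leRHS]eq_integral do rewrite restrict_EFin.
  apply: ge0_subset_integral => //; first exact: mf1.
  by move=> t _; rewrite lee_fin.
- exact: measurable_expRN.
- by move=> t _; rewrite lee_fin.
- exact: mf1.
Qed.

(** The same cut from the other side: before [d] the factor [e^d e^-t] is at least 1, and between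
    [d] and [s] the base is at most its value at [d], on a length of at most [s]. *)
Lemma record_prob_lower (d s : R) g : 0 <= d -> d <= s -> k`!%:R^-1 * s ^+ k = 1 ->
  s / nbin (1 + k%:R^-1) g <= expR d * p g.+1 + s * (1 - k`!%:R^-1 * d ^+ k) ^+ g.
Proof.
move=> d0 ds cs; set c := k`!%:R^-1 in cs *; set r := 1 - _.
have s0 : 0 <= s by exact: le_trans ds.
have c0 : 0 <= c by rewrite invr_ge0 ltW.
have r0 : 0 <= r by rewrite subr_ge0 -cs ler_wpM2l// lerXn2r.
rewrite -lee_fin EFinD [in leRHS]EFinM pE -(ebeta g s0 cs).
apply: (@le_trans _ _ (\int[mu]_(t in `[0%R, s])
    ((expR d)%:E * (expR (- t) * q t ^+ g)%:E + (r ^+ g)%:E))%E).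
  apply: ge0_le_integral => //.
  - move=> t; rewrite /= in_itv/= => ts; rewrite lee_fin.
    exact: Rintegral_base_ge0 cs _ ts.
  - exact: mbase.
  - by apply: emeasurable_funD => //; apply: measurable_funeM; exact: mintegrand.
  move=> t; rewrite /= in_itv/= => /andP[t0 ts]; rewrite -EFinM -EFinD lee_fin.
  have [td|dt] := leP t d.
    rewrite -[leLHS]addr0 lerD//; last by rewrite exprn_ge0.
    rewrite mulrA -expRD -[leLHS]mul1r ler_pM//.
    - by apply: (Rintegral_base_ge0 g c0 s0 cs); rewrite t0.
    - by rewrite -expR0 ler_expR subr_ge0.
    rewrite lerXn2r ?nnegrE//.
      have := Rintegral_base_ge0 1 c0 s0 cs (t := t).
      by rewrite expr1; apply; rewrite t0.
    by rewrite mulrC; exact: q_lower.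
  rewrite -[leLHS]add0r lerD//.
    by rewrite !mulr_ge0 ?expR_ge0// exprn_ge0.
  rewrite lerXn2r ?nnegrE//.
    have := Rintegral_base_ge0 1 c0 s0 cs (t := t).
    by rewrite expr1; apply; rewrite t0.
  by rewrite lerD2l lerN2 ler_wpM2l// lerXn2r// ?nnegrE ltW.
rewrite ge0_integralD//; last 3 first.
- move=> t _; rewrite -EFinM lee_fin; apply: mulr_ge0; rewrite ?expR_ge0//.
  by rewrite mulr_ge0 ?expR_ge0// exprn_ge0.
- by apply: measurable_funeM; exact: mintegrand.
- by move=> t _; rewrite lee_fin exprn_ge0.
rewrite ge0_integralZl_EFin ?expR_ge0//.
rewrite integral_cst//= lebesgue_measure_itv/= lte_fin.
apply: leeD.
  apply: lee_wpmul2l; first by rewrite lee_fin expR_ge0.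
  apply: ge0_subset_integral => //; first exact: mintegrand.
  by apply: subset_itvl; rewrite bnd_simp.
case: ifP => _; last by rewrite mule0 lee_fin mulr_ge0// exprn_ge0.
by rewrite sube0 -EFinM mulrC.
exact: mintegrand.
Qed.

Let x : R := k%:R^-1.

Let x01 : 0 <= x <= 1.
Proof. by rewrite invr_ge0 ler0n/= invf_le1 ?ltr0n// ler1n. Qed.

Let s0 : R := k`!%:R `^ x.

Let s0X : s0 ^+ k = k`!%:R.
Proof.
rewrite -powR_mulrn ?powR_ge0// /s0 -powRrM mulVf ?powRr1// ?(ltW kf0)//.
by rewrite pnatr_eq0 -lt0n.
Qed.

Let s0_ge1 : 1 <= s0.
Proof. by rewrite -[leLHS](powRr0 k`!%:R) ler_powR ?ler1n ?fact_gt0//; case/andP: x01. Qed.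

Lemma cvg_record_prob : p g.+1 * nbin (1 + x) g @[g --> \oo] --> s0.
Proof.
have s0gt0 : 0 < s0 by exact: lt_le_trans s0_ge1.
have b0 g : 0 < nbin (1 + x) g by rewrite nbin_gt0// ltr_pwDl//; case/andP: x01.
apply/cvgrPdist_le => e e0.
have e20 : 0 < e / (2 * s0) by rewrite divr_gt0// mulr_gt0.
have ln0 : 0 < ln (1 + e / (2 * s0)) by rewrite ln_gt0// ltrDl.
(* The bound by 1, hence by [s0], keeps the cut inside the range of both estimates; the logarithm
   makes [s0 * expR d] exceed [s0] by at most [e / 2]. *)
pose d := Num.min 1 (ln (1 + e / (2 * s0))).
have d0 : 0 < d by rewrite lt_min ltr01 ln0.
have d1 : d <= 1 by rewrite ge_min lexx.
have ed : expR d <= 1 + e / (2 * s0).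
  by rewrite -[leRHS]lnK ?posrE ?addr_gt0// ler_expR ge_min lexx orbT.
have ed1 : 1 <= expR d by rewrite -expR0 ler_expR ltW.
have sd : s0 * expR d <= s0 + e / 2.
  rewrite (_ : s0 + e / 2 = s0 * (1 + e / (2 * s0))); first by rewrite ler_pM2l.
  by field; rewrite gt_eqF.
pose r1 := 1 - expR (- d) * d ^+ k / k`!%:R; pose r2 := 1 - k`!%:R^-1 * d ^+ k.
have dk : 0 < d ^+ k <= 1 by rewrite exprn_gt0// exprn_ile1// ltW.
have fV : 0 < (k`!%:R^-1 : R) <= 1 by rewrite invr_gt0 kf0 invf_le1// ler1n fact_gt0.
have r201 : 0 <= r2 < 1.
  case/andP: dk fV => dk0 dk1 /andP[f0 f1]; rewrite subr_ge0 ltrBlDr ltrDl mulr_gt0//.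
  by rewrite mulr_ile1// ltW.
have r101 : 0 <= r1 < 1.
  case/andP: dk fV => dk0 dk1 /andP[f0 f1].
  rewrite subr_ge0 ltrBlDr ltrDl !mulr_gt0 ?expR_gt0//.
  rewrite !mulr_ile1 ?mulr_ge0 ?expR_ge0 ?(ltW dk0) ?(ltW f0)//.
  by rewrite expR_le1 oppr_le0 ltW.
have c1 := cvg_geometric_nbin r101 x01.
have c2 := cvg_geometric_nbin r201 x01.
near=> g.
have n1 : r1 ^+ g * nbin (1 + x) g <= e / 2.
  apply: (le_trans (ler_norm _)); rewrite -normrN -sub0r.
  near: g; move/cvgrPdist_le: c1; apply; exact: divr_gt0.
have n2 : r2 ^+ g * nbin (1 + x) g <= e / (2 * s0).
  apply: (le_trans (ler_norm _)); rewrite -normrN -sub0r.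
  by near: g; move/cvgrPdist_le: c2; apply.
have up : p g.+1 * nbin (1 + x) g <= s0 * expR d + e / 2.
  have edk : expR (d / k%:R) ^+ k = expR d.
    by rewrite -expRM_natr divfK// pnatr_eq0 -lt0n.
  (* This is the zero of [1 - e^-d t^k / k!]; it is at most [s0 * expR d]. *)
  have := @record_prob_upper d (s0 * expR (d / k%:R)) g (ltW d0).
  rewrite mulr_ge0 ?expR_ge0 ?(ltW s0gt0)// exprMn s0X edk => /(_ isT).
  have -> : expR (- d) / k`!%:R * (k`!%:R * expR d) = 1.
    by rewrite mulrA divfK ?gt_eqF// expRN mulVf// gt_eqF ?expR_gt0.
  have ek1 : 1 <= expR (d / k%:R) by rewrite -expR0 ler_expR divr_ge0// ltW.
  have ds : d <= s0 * expR (d / k%:R).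
    by rewrite (le_trans d1)// (le_trans s0_ge1)// ler_peMr// ltW.
  move=> /(_ erefl ds).
  rewrite -(ler_pM2r (b0 g)) mulrDl divfK ?gt_eqF// => h.
  apply: le_trans h _; apply: lerD => //.
  rewrite ler_wpM2l ?(ltW s0gt0)// ler_expR ler_pdivrMr ?ltr0n//.
  by rewrite ler_peMr ?(ltW d0)// ler1n.
have lo : s0 <= expR d * (p g.+1 * nbin (1 + x) g) + e / 2.
  have := @record_prob_lower d s0 g (ltW d0) (le_trans d1 s0_ge1).
  rewrite s0X mulVf ?gt_eqF// => /(_ erefl).
  rewrite -(ler_pM2r (b0 g)) mulrDl divfK ?gt_eqF// -!mulrA => h.
  apply: le_trans h _; rewrite lerD2l -ler_pdivlMl//.
  apply: le_trans n2 _; rewrite le_eqVlt; apply/orP; left; apply/eqP; field.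
  by rewrite gt_eqF.
rewrite ler_norml; apply/andP; split; first lra.
have p0 : 0 <= p g.+1 * nbin (1 + x) g.
  apply: mulr_ge0; last exact: ltW.
  by rewrite -lee_fin pE; apply: integral_ge0 => t _; exact: integrand_ge0.
rewrite lerBlDr.
(* Otherwise the quantity is below [s0], so removing its factor [expR d] from [lo] costs at most
   [e / 2]. *)
have [//|pl] := leP s0 (e + p g.+1 * nbin (1 + x) g).
have : (expR d - 1) * (p g.+1 * nbin (1 + x) g) <= e / (2 * s0) * s0.
  by rewrite ler_pM// ?subr_ge0//; lra.
rewrite (_ : e / (2 * s0) * s0 = e / 2); last by field; rewrite gt_eqF.
by lra.
Unshelve. all: by end_near. Qed.

(** The reciprocal of [nbin (1 + x) n] is traded for [nbin (1 - x) n.+1]: their product is a partial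
    sine product up to the factor [1 - x / (n + 1)] due to the shifted index. *)
Lemma cvg_record_ratio : (1 < k)%N ->
  p n.+1 / nbin (1 - x) n.+1 @[n --> \oo] --> s0 * (sin (pi * x) / (pi * x))^-1.
Proof.
move=> k1.
have x0 : 0 < x by rewrite invr_gt0 ltr0n.
have x1 : x < 1 by rewrite invf_lt1 ?ltr0n// ltr1n.
have sx : 0 < sin (pi * x) / (pi * x).
  rewrite divr_gt0 ?mulr_gt0 ?pi_gt0// sin_gt0_pi// mulr_gt0 ?pi_gt0//=.
  by rewrite gtr_pMr ?pi_gt0.
have c1 : nbin (1 - x) n.+1 * nbin (1 + x) n @[n --> \oo] --> sin (pi * x) / (pi * x).
  have -> : (fun n => nbin (1 - x) n.+1 * nbin (1 + x) n) =
      (fun n => nbin (1 - x) n * nbin (1 + x) n * (1 - x * n.+1%:R^-1)).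
    apply/funext => n; rewrite nbinS.
    by field; rewrite nat1r pnatr_eq0.
  rewrite -[X in _ --> X]mulr1.
  apply: cvgM.
    under eq_cvg do rewrite nbin_reflect.
    by apply: sine_product; rewrite x0.
  rewrite -[X in _ --> X]subr0; apply: cvgB; first exact: cvg_cst.
  rewrite -[X in _ --> X](mulr0 x); apply: cvgM; first exact: cvg_cst.
  exact: cvg_harmonic.
have -> : (fun n => p n.+1 / nbin (1 - x) n.+1) =
    (fun n => p n.+1 * nbin (1 + x) n * (nbin (1 - x) n.+1 * nbin (1 + x) n)^-1).
  apply/funext => n; field.
  by rewrite !gt_eqF// nbin_gt0// ?subr_gt0// addr_gt0.
by apply: cvgM; [exact: cvg_record_prob|apply: cvgV => //; rewrite gt_eqF].
Qed.

End Survival.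

End RecordIntegral.

(** * Independent blocks of variables *)

Section Density.
Context {d} {S : measurableType d} {R : realType}.
Context (mu m : {measure set S -> \bar R}) (g : S -> R).
Hypotheses (g0 : forall x, 0 <= g x) (mg : measurable_fun setT g)
  (mE : forall A, measurable A -> m A = (\int[mu]_(x in A) (g x)%:E)%E).
Import HBNNSimple.
Local Open Scope ereal_scope.

Let integral_density_nnsfun (h : {nnsfun S >-> R}) :
  \int[m]_x (h x)%:E = \int[mu]_x ((h x)%:E * (g x)%:E).
Proof.
have mgE : measurable_fun setT (fun x => (g x)%:E) by exact/measurable_EFinP.
rewrite integralT_nnsfun sintegralE.
transitivity (\int[mu]_x \sum_(k \in range h)
    (k%:E * ((\1_(h @^-1` [set k]) x)%:E * (g x)%:E))); last first.
  apply: eq_integral => x _.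
  rewrite [in RHS]fimfunE -fsumEFin// ge0_mule_fsuml => [|y]; last first.
    exact: nnfun_muleindic_ge0.
  by apply: eq_fsbigr => k _; rewrite EFinM muleA.
have ind0 k x : 0 <= (\1_(h @^-1` [set k]) x : R)%:E * (g x)%:E.
  by rewrite mule_ge0 ?lee_fin.
have mind k : measurable_fun setT
    (fun x => (\1_(h @^-1` [set k]) x)%:E * (g x)%:E).
  by apply: emeasurable_funM => //; apply/measurable_EFinP.
rewrite ge0_integral_fsum//; last 2 first.
- by move=> k; exact: measurable_funeM.
- move=> k x _; have [k0|k0] := leP 0%R k; first by rewrite mule_ge0.
  rewrite indicE memNset ?mul0e ?mule0// => /= hx.
  by move: k0; rewrite -hx ltNge fun_ge0.
apply: eq_fsbigr => k; rewrite inE => -[x _ hx].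
rewrite ge0_integralZl//; last by rewrite lee_fin -hx fun_ge0.
congr (_ * _); rewrite mE//.
rewrite [LHS]integral_mkcond; apply: eq_integral => y _.
rewrite patchE indicE; case: ifPn; rewrite ?mul1e ?mul0e//.
Qed.

(** Simple functions, then monotone convergence. It serves twice: for the exponential law, and, with
    an indicator as density, for the restriction of [P] to an event. *)
Lemma ge0_integral_density (f : S -> \bar R) :
  measurable_fun setT f -> (forall x, 0 <= f x) ->
  \int[m]_x f x = \int[mu]_x (f x * (g x)%:E).
Proof.
move=> mf f0; pose h := nnsfun_approx measurableT mf.
have hf x : EFin \o h ^~ x @ \oo --> f x by exact: cvg_nnsfun_approx.
have nd x : {homo (fun n => (h n x)%:E) : a b / (a <= b)%N >-> a <= b}.
  by move=> a b ab; rewrite lee_fin; exact/lefP/nd_nnsfun_approx.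
transitivity (limn (fun n => \int[m]_x (h n x)%:E)).
  rewrite -monotone_convergence//.
  - by apply: eq_integral => x _; apply/esym/cvg_lim => //; exact: hf.
  - by move=> n; exact/measurable_EFinP/measurable_funP.
  - by move=> n x _; rewrite lee_fin.
transitivity (limn (fun n => \int[mu]_x ((h n x)%:E * (g x)%:E))).
  by congr (limn _); apply/funext => n; exact: integral_density_nnsfun.
rewrite -monotone_convergence//.
- apply: eq_integral => x _; apply/cvg_lim => //.
  by apply: cvgeZr => //; exact: hf.
- move=> n; apply: emeasurable_funM; apply/measurable_EFinP => //.
- by move=> n x _; rewrite mule_ge0 ?lee_fin.
- by move=> x _ a b ab; rewrite lee_wpmul2r ?lee_fin//; exact: nd.
Qed.

End Density.

Section IndependentBlocks.
Context {d : measure_display} {Omega : measurableType d} {R : realType}.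
Context (P : probability Omega R) (I : choiceType) (D0 : set I).
Context (X : I -> {RV P >-> R}).
Hypothesis indep : mutually_independent D0 X.

Definition cylinder (D : set I) : set (set Omega) :=
  [set A | exists (J : {fset I}) (B : I -> set R), [/\ [set` J] `<=` D,
    forall i, measurable (B i) & A = \bigcap_(i in [set` J]) (X i @^-1` B i)]].

(** The sample space with the sigma-algebra generated by the [X i], [i] in [D]. *)
Definition block (D : set I) := g_sigma_algebraType (cylinder D).

Lemma cylinder_measurable D : cylinder D `<=` measurable.
Proof.
move=> _ [J [B [_ mB ->]]]; apply: fin_bigcap_measurable => //.
by move=> i _; rewrite -[_ @^-1` _]setTI; exact: measurable_funP.
Qed.

Lemma block_measurable D (A : set Omega) : <<s cylinder D >> A -> measurable A.
Proof.
apply: smallest_sub; first exact: sigma_algebra_measurable.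
exact: cylinder_measurable.
Qed.

Lemma sub_cylinder D1 D2 : D1 `<=` D2 -> cylinder D1 `<=` cylinder D2.
Proof.
move=> D12 A [J [B [JD mB AE]]]; exists J, B; split => //.
exact: subset_trans D12.
Qed.

Lemma sub_block D1 D2 (A : set Omega) : D1 `<=` D2 ->
  <<s cylinder D1 >> A -> <<s cylinder D2 >> A.
Proof. by move=> D12; apply: sub_sigma_algebra2; exact: sub_cylinder. Qed.

Lemma cylinderT D : cylinder D setT.
Proof.
exists fset0, (fun=> setT); split => //.
by rewrite set_fset0 bigcap_set0.
Qed.

Lemma cylinder_setI (J1 J2 : {fset I}) (B1 B2 : I -> set R) :
  (forall i, measurable (B1 i)) -> (forall i, measurable (B2 i)) ->
  let B i := (if i \in J1 then B1 i else setT) `&` (if i \in J2 then B2 i else setT) in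
  (forall i, measurable (B i)) /\
  (\bigcap_(i in [set` J1]) (X i @^-1` B1 i)) `&` (\bigcap_(i in [set` J2]) (X i @^-1` B2 i))
  = \bigcap_(i in [set` (J1 `|` J2)%fset]) (X i @^-1` B i).
Proof.
move=> m1 m2 B; split.
  by move=> i; apply: measurableI; case: ifP.
apply/seteqP; split => w.
  move=> [h1 h2] i /=; rewrite inE => iJ; rewrite /B/=.
  by split; case: ifP => // iJ'; [exact: h1|exact: h2].
move=> h; split => i /= iJ.
  by have := h i; rewrite /= inE iJ /B/= iJ => /(_ isT) [].
by have := h i; rewrite /= inE iJ orbT /B/= iJ => /(_ isT) [].
Qed.

Lemma setI_closed_cylinder D : setI_closed (cylinder D).
Proof.
move=> _ _ [J1 [B1 [JD1 mB1 ->]]] [J2 [B2 [JD2 mB2 ->]]].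
have [mB ->] := cylinder_setI J1 J2 mB1 mB2.
eexists; eexists; split; last reflexivity; last exact: mB.
by rewrite set_fsetU subUset.
Qed.

Lemma indep_cylinder D1 D2 A1 A2 : D1 `<=` D0 -> D2 `<=` D0 ->
  (forall i, D1 i -> ~ D2 i) -> cylinder D1 A1 -> cylinder D2 A2 ->
  (P (A1 `&` A2) = P A1 * P A2)%E.
Proof.
move=> D10 D20 D12 [J1 [B1 [JD1 mB1 ->]]] [J2 [B2 [JD2 mB2 ->]]].
have [mB ->] := cylinder_setI J1 J2 mB1 mB2.
rewrite !indep//; [|exact: subset_trans D20|exact: subset_trans D10|]; last first.
  by rewrite set_fsetU subUset; split; [exact: subset_trans D10|exact: subset_trans D20].
have J12 i : i \in J1 -> i \in J2 = false.
  by move=> i1; apply/negP => i2; apply: (D12 i); [exact: JD1|exact: JD2].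
rewrite (big_fsetID _ (mem J1))/=; congr (_ * _)%E.
- rewrite (eq_fbigl _ (B := J1)); last first.
    by move=> i; rewrite !inE/=; case: (i \in J1); rewrite ?andbT ?andbF.
  rewrite big_seq [RHS]big_seq; apply: eq_bigr => i i1.
  by rewrite i1 J12// setIT.
- rewrite (eq_fbigl _ (B := J2)); last first.
    move=> i; rewrite !inE/=; case: (boolP (i \in J1)) => [/J12 -> //|/= _].
    by rewrite andbT.
  rewrite big_seq [RHS]big_seq; apply: eq_bigr => i i2.
  by rewrite i2; case: ifPn => [/J12|]; rewrite ?i2// setTI.
Qed.

(** As functions of [C1], both sides are finite measures that agree on the cylinders, a generating
    family stable under intersection. Used once for each of the two events in [indep_block]. *)
Lemma indep_extend D C2 : measurable C2 ->
  (forall C1, cylinder D C1 -> P (C1 `&` C2) = P C1 * P C2)%E ->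
  forall C1, <<s cylinder D >> C1 -> (P (C1 `&` C2) = P C1 * P C2)%E.
Proof.
move=> mC2 h C1 sC1.
pose m1 : {measure set Omega -> \bar R} := mrestr P mC2.
pose r : {nonneg R} := NngNum (fine_ge0 (measure_ge0 P C2)).
pose m2 : {measure set Omega -> \bar R} := mscale r P.
have m2E C : m2 C = (P C * P C2)%E.
  have rE : (r%:num)%:E = P C2 by apply: fineK; exact: fin_num_measure.
  by rewrite muleC -rE.
rewrite -m2E -[LHS]/(m1 C1).
apply: (g_sigma_algebra_measure_unique (cylinder D) _ (fun=> setT)) => //.
- exact: cylinder_measurable.
- by move=> _; exact: cylinderT.
- by rewrite bigcup_const.
- exact: setI_closed_cylinder.
- by move=> C cC; rewrite m2E; exact: h.
- move=> _; rewrite -[m1 setT]/(P (setT `&` C2)) setTI.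
  by rewrite -ge0_fin_numE ?measure_ge0// fin_num_measure.
Qed.

Lemma indep_block D1 D2 A1 A2 : D1 `<=` D0 -> D2 `<=` D0 ->
  (forall i, D1 i -> ~ D2 i) -> <<s cylinder D1 >> A1 -> <<s cylinder D2 >> A2 ->
  (P (A1 `&` A2) = P A1 * P A2)%E.
Proof.
move=> D10 D20 D12 s1 s2.
apply: (indep_extend (block_measurable s2)) s1 => C1 c1.
rewrite setIC muleC.
apply: (indep_extend (cylinder_measurable c1)) s2 => C2 c2.
rewrite setIC muleC.
exact: indep_cylinder D10 D20 D12 c1 c2.
Qed.

Lemma measurable_block D i : D i ->
  measurable_fun [set: block D] (X i : block D -> R).
Proof.
move=> Di _ B mB; rewrite setTI; apply: sub_sigma_algebra.
exists [fset i]%fset, (fun=> B); split => //.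
  by move=> j /=; rewrite inE => /eqP ->.
by rewrite set_fset1 bigcap_set1.
Qed.

Lemma measurable_block_id D : measurable_fun [set: Omega] (id : Omega -> block D).
Proof. by move=> _ B mB; rewrite setTI; exact: block_measurable mB. Qed.

(** The identity into [block D] is a random variable whose law is [P] on the coarser sigma-algebra;
    measurability of sections is applied to that law. *)
Lemma measurable_block_xsection D (C : set (R * block D)) : measurable C ->
  measurable_fun [set: R] (fun x => P (xsection C x)).
Proof.
move=> mC.
pose Y : {mfun Omega >-> block D} := HB.pack (id : Omega -> block D)
  (isMeasurableFun.Build _ _ _ _ _ (@measurable_block_id D)).
exact: (@measurable_fun_xsection _ _ _ _ R (distribution P Y) C mC).
Qed.

(** Conditioning on [X i]: by independence on rectangles, the joint law of [X i] and of the block is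
    the product of their laws. *)
Lemma block_fubini D i (C : set (R * block D)) : D `<=` D0 -> D0 i -> ~ D i ->
  measurable C ->
  (P [set w | C (X i w, w)] = \int[distribution P (X i)]_x P (xsection C x))%E.
Proof.
move=> DD0 D0i Di mC.
have mpair : measurable_fun [set: Omega] (fun w => (X i w, w : block D)).
  by apply: measurable_fun_pair => //; exact: measurable_block_id.
pose Y : {mfun Omega >-> block D} := HB.pack (id : Omega -> block D)
  (isMeasurableFun.Build _ _ _ _ _ (@measurable_block_id D)).
pose Z : {mfun Omega >-> (R * block D)%type} := HB.pack (fun w => (X i w, w : block D))
  (isMeasurableFun.Build _ _ _ _ _ mpair).
rewrite -[LHS]/(distribution P Z C).
rewrite -(@product_measure_unique _ _ _ _ R (distribution P (X i)) (distribution P Y)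
  (distribution P Z) _ C mC)//.
move=> A B mA mB.
rewrite -[LHS]/(P ((X i @^-1` A) `&` B)).
rewrite (indep_block (D1 := [set i]) (D2 := D))//.
- by move=> j ->.
- by move=> j ->.
- have := @measurable_block [set i] i erefl measurableT A mA.
  by rewrite setTI.
Qed.

(** On the sigma-algebra of [D1], the restriction of [P] to [B] coincides with [P B] times [P];
    since [U] is measurable there, both integrals can be computed with the coarser measures. *)
Lemma indep_block_integral D1 D2 (U : Omega -> \bar R) B : D1 `<=` D0 -> D2 `<=` D0 ->
  (forall i, D1 i -> ~ D2 i) ->
  measurable_fun [set: block D1] (U : block D1 -> \bar R) -> (forall w, 0 <= U w)%E ->
  <<s cylinder D2 >> B ->
  (\int[P]_w (U w * (\1_B w)%:E) = P B * \int[P]_w U w)%E.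
Proof.
move=> D10 D20 D12 mU U0 sB; have mB := block_measurable sB.
have mid := @measurable_block_id D1.
have mUP : measurable_fun [set: Omega] U := measurableT_comp mU mid.
rewrite -(ge0_integral_density (m := mrestr P mB))//; last first.
by move=> A mA; rewrite integral_indic// setIC.
pose Y : {mfun Omega >-> block D1} := HB.pack (id : Omega -> block D1)
  (isMeasurableFun.Build _ _ _ _ _ mid).
pose r : {nonneg R} := NngNum (fine_ge0 (measure_ge0 P B)).
have rE : (r%:num)%:E = P B by apply: fineK; exact: fin_num_measure.
rewrite -[LHS](@ge0_integral_pushforward _ _ Omega (block D1) R Y mid (mrestr P mB) setT U)//.
rewrite -[X in (_ * X)%E](@ge0_integral_pushforward _ _ Omega (block D1) R Y mid P setT U)//.
rewrite -rE -ge0_integral_mscale//.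
apply: eq_measure_integral => A mA _.
rewrite /= /mscale/= /pushforward/= /mrestr/= rE muleC.
exact: indep_block D10 D20 D12 mA sB.
Qed.

End IndependentBlocks.

(** * Probabilities of records *)

Section RecordProbabilities.
Context {R : realType} {d : measure_display} {Omega : measurableType d}.
Context (P : probability Omega R) (T : nat -> nat -> {RV P >-> R}).
Hypothesis hT : iid_exp1 T.
Notation mu := (@lebesgue_measure R).

Let D0 : set (nat * nat) := [set p | (1 <= p.1)%N /\ (1 <= p.2)%N].
Let X (p : nat * nat) := T p.1 p.2.
Let indep : mutually_independent D0 X. Proof. exact: hT.2. Qed.

Lemma integral_exp1 i j (f : R -> \bar R) : (1 <= i)%N -> (1 <= j)%N ->
  measurable_fun setT f -> (forall x, 0 <= f x)%E ->
  (\int[distribution P (T i j)]_x f x =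
   \int[mu]_(x in `[0%R, +oo[) (f x * (expR (- x))%:E))%E.
Proof.
move=> i1 j1 mf f0.
(* Lebesgue measure lives on [measurableTypeR R], which is not the canonical
   measurable structure of [R]. *)
have mX : measurable_fun [set: Omega] (T i j : Omega -> measurableTypeR R).
  by move=> mO A mA; have := @measurable_funPT _ _ _ _ (T i j) mO A mA.
pose Y : {mfun Omega >-> measurableTypeR R} :=
  HB.pack (T i j : Omega -> measurableTypeR R) (isMeasurableFun.Build _ _ _ _ _ mX).
have mf' : measurable_fun [set: measurableTypeR R] (f : measurableTypeR R -> \bar R).
  exact: mf.
transitivity (\int[distribution P Y]_y f y)%E.
  by rewrite !ge0_integral_distribution.
rewrite (@ge0_integral_density _ _ _ mu (distribution P Y) (exponential_pdf 1))//.
- rewrite [RHS]integral_mkcond; apply: eq_integral => x _.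
  rewrite /exponential_pdf !patchE; case: ifP => _; last by rewrite mule0.
  by rewrite mulN1r mul1r.
- by move=> x; exact: exponential_pdf_ge0.
- exact: measurable_exponential_pdf.
- by move=> A mA; exact: hT.1.
Qed.

Lemma measurable_sum_cond {d'} {S : measurableType d'} (s : seq nat) (p : pred nat)
    (f : nat -> S -> R) : (forall i, p i -> measurable_fun setT (f i)) ->
  measurable_fun setT (fun w => \sum_(i <- s | p i) f i w).
Proof.
move=> mf; elim: s => [|i s IH].
  have -> : (fun w => \sum_(i <- [::] | p i) f i w) = cst 0.
    by apply/funext => w; rewrite big_nil.
  exact: measurable_cst.
under eq_fun do rewrite big_cons.
by case: (boolP (p i)) => // pi; apply: measurable_funD; [exact: mf|exact: IH].
Qed.

Definition rows r j : set (nat * nat) := [set p | (1 <= p.1 <= r)%N /\ p.2 = j].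
(** Open on the left, so that [cols a b] and [cols b c] are disjoint and the column of a chosen
    record belongs to the gap that it ends. *)
Definition cols a b : set (nat * nat) := [set p | (1 <= p.1)%N /\ (a < p.2 <= b)%N].

Lemma measurable_Gsum D r j : rows r j `<=` D ->
  measurable_fun [set: block X D] (Gsum T r j : block X D -> R).
Proof.
move=> rD; rewrite /Gsum.
have -> : (fun w => \sum_(1 <= i < r.+1) T i j w) =
    (fun w => \sum_(i <- index_iota 1 r.+1 | (1 <= i < r.+1)%N) X (i, j) w).
  apply/funext => w; rewrite [LHS]big_nat_cond.
  by apply: eq_bigl => i; rewrite andbT.
apply: measurable_sum_cond => i ir.
by apply: measurable_block; apply: rD; split => //=; rewrite -ltnS.
Qed.

Lemma GsumS r j w : Gsum T r.+1 j w = Gsum T r j w + T r.+1 j w.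
Proof. by rewrite /Gsum big_nat_recr. Qed.

Lemma block_fubini_exp1 D i j (C : set (R * block X D)) : D `<=` D0 ->
  (1 <= i)%N -> (1 <= j)%N -> ~ D (i, j) -> measurable C ->
  (P [set w | C (T i j w, w)] =
   \int[mu]_(x in `[0%R, +oo[) (P (xsection C x) * (expR (- x))%:E))%E.
Proof.
move=> DD0 i1 j1 Dij mC.
rewrite (@block_fubini _ _ _ _ _ _ _ indep _ (i, j) C)// integral_exp1//.
exact: measurable_block_xsection.
Qed.

Lemma measurable_setlt {d' : measure_display} {S : measurableType d'} (f g : S -> R) :
  measurable_fun setT f -> measurable_fun setT g -> measurable [set x | f x < g x].
Proof.
move=> mf mg; rewrite -[X in measurable X]setTI.
rewrite (_ : [set x | f x < g x] = [set x | ((f x)%:E < (g x)%:E)%E]).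
  by apply: measurable_lte => //; exact/measurable_EFinP.
by apply/seteqP; split => x /=; rewrite lte_fin.
Qed.

Lemma measurable_setle {d' : measure_display} {S : measurableType d'} (f g : S -> R) :
  measurable_fun setT f -> measurable_fun setT g -> measurable [set x | f x <= g x].
Proof.
move=> mf mg; rewrite (_ : [set x | f x <= g x] = ~` [set x | g x < f x]).
  by apply: measurableC; exact: measurable_setlt.
by apply/seteqP; split => x /=; [move=> h; apply/negP; rewrite -leNgt|move/negP; rewrite -leNgt].
Qed.

Lemma rows_sub r j : (1 <= j)%N -> rows r j `<=` D0.
Proof. by move=> j1 p [/andP[p1 _] pj]; split => //; rewrite pj. Qed.

Lemma cols_sub a b : cols a b `<=` D0.
Proof. by move=> [i j] /= [i1 /andP[aj _]]; split => //=; exact: leq_ltn_trans aj. Qed.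

(** Conditioning on the last summand. All later facts on the law of [Gsum] follow from this
    recurrence by induction on [r]. *)
Lemma Gsum_cdfS r j (t : R) : (1 <= j)%N ->
  (P [set w | (Gsum T r.+1 j w <= t)%R] =
   \int[mu]_(x in `[0%R, +oo[) (P [set w | (Gsum T r j w <= t - x)%R] * (expR (- x))%:E))%E.
Proof.
move=> j1.
pose C : set (R * block X (rows r j)) := [set z | Gsum T r j z.2 <= t - z.1].
have mG := @measurable_Gsum (rows r j) r j (fun _ h => h).
have mC : measurable C.
  apply: measurable_setle; first exact: (measurableT_comp mG measurable_snd).
  by apply: measurable_funB; [exact: measurable_cst|exact: measurable_fst].
have := @block_fubini_exp1 _ r.+1 j C (rows_sub (r := r) j1) isT j1 _ mC.
have -> : [set w | C (T r.+1 j w, w)] = [set w | Gsum T r.+1 j w <= t].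
  by apply/seteqP; split => w; rewrite /C/= GsumS lerBrDr.
move=> ->; last by move=> [/=]; rewrite ltnn.
apply: eq_integral => x _; congr (P _ * _)%E.
by rewrite /xsection /C; apply/seteqP; split => w /=; rewrite inE.
Qed.

Lemma Gsum_cdf_lt0 r j (t : R) : (1 <= j)%N -> t < 0 -> P [set w | Gsum T r j w <= t] = 0%E.
Proof.
move=> j1; elim: r t => [|r IH] t t0.
  rewrite (_ : [set _ | _] = set0) ?measure0//; apply/seteqP; split => // w /=.
  by rewrite /Gsum big_nil leNgt t0.
rewrite Gsum_cdfS// integral0_eq// => x; rewrite /= in_itv/= andbT => x0.
by rewrite IH ?mul0e//; lra.
Qed.

Lemma Gsum_cdf_eq r j (t : R) : (1 <= j)%N ->
  P [set w | Gsum T r j w <= t] = P [set w | Gsum T r 1 w <= t].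
Proof.
move=> j1; elim: r t => [|r IH] t.
  by congr (P _); apply/seteqP; split => w; rewrite /= /Gsum !big_nil.
by rewrite !Gsum_cdfS//; apply: eq_integral => x _; rewrite IH.
Qed.

Lemma measurable_Gsum_RV r j : measurable_fun [set: Omega] (Gsum T r j).
Proof.
have mG := @measurable_Gsum (rows r j) r j (fun _ h => h).
exact: (measurableT_comp mG (@measurable_block_id _ _ _ _ _ X _)).
Qed.

Lemma measurable_Gsum_cdf r j (t : R) :
  measurable_fun setT (fun x : R => P [set w | (Gsum T r j w <= t - x)%R]).
Proof.
pose C : set (R * block X (rows r j)) := [set z | Gsum T r j z.2 <= t - z.1].
have mG := @measurable_Gsum (rows r j) r j (fun _ h => h).
have mC : measurable C.
  apply: measurable_setle; first exact: (measurableT_comp mG measurable_snd).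
  by apply: measurable_funB; [exact: measurable_cst|exact: measurable_fst].
have := measurable_block_xsection mC; congr measurable_fun.
apply/funext => x; congr (P _).
by rewrite /xsection /C; apply/seteqP; split => w /=; rewrite inE.
Qed.

Let pow_sub r (t : R) : 0 <= t ->
  (\int[mu]_(x in `[0%R, t]) ((t - x) ^+ r / r`!%:R)%:E = (t ^+ r.+1 / r.+1`!%:R)%:E)%E.
Proof.
move=> t0.
have cf : continuous (fun x : R => (t - x) ^+ r / r`!%:R).
  move=> x; apply: cvgM; last exact: cvg_cst.
  apply: (@continuous_exprn _ (fun x => t - x)) => y.
  by apply: cvgB; [exact: cvg_cst|exact: cvg_id].
have -> : t ^+ r.+1 / r.+1`!%:R = \int[mu]_(x in `[0, t]) ((t - x) ^+ r / r`!%:R).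
  apply: esym; apply: etrans.
    apply: (@Rintegral_derive _ (fun x => - ((t - x) ^+ r.+1 / r.+1`!%:R))) => //.
    move=> x.
    have db : is_derive x (1 : R) (fun x => t - x) (- 1).
      by apply: is_derive_eq; ring.
    have dX := is_derive_exprn r db.
    have r0 : r`!%:R != 0 :> R by rewrite pnatr_eq0 -lt0n fact_gt0.
    apply: is_derive_eq; rewrite /GRing.scale/= factS natrM; field.
    by rewrite r0 nat1r pnatr_eq0.
  by rewrite /= subrr expr0n/= mul0r oppr0 sub0r opprK addr0.
rewrite /Rintegral fineK//; apply: integrable_fin_num => //.
exact: continuous_integrable.
Qed.

Let mpow r (t : R) (D : set R) :
  measurable_fun D (fun x => ((t - x) ^+ r / r`!%:R)%:E).
Proof.
apply/measurable_EFinP; apply: measurable_funTS; apply: measurable_funM => //.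
by apply: measurable_funX; apply: measurable_funB => //.
Qed.

Let mcdf_exp r j (t : R) (D : set R) : measurable_fun D
  (fun x => P [set w | (Gsum T r j w <= t - x)%R] * (expR (- x))%:E)%E.
Proof.
apply: emeasurable_funM; last exact: measurable_expRN.
by apply: measurable_funTS; exact: measurable_Gsum_cdf.
Qed.

(** The bound is the volume of a simplex, on which the joint density is at most 1; in the recurrence
    this is [e^-x <= 1]. *)
Lemma Gsum_cdf_le r j (t : R) : (1 <= j)%N -> 0 <= t ->
  (P [set w | (Gsum T r j w <= t)%R] <= (t ^+ r / r`!%:R)%:E)%E.
Proof.
move=> j1; elim: r t => [|r IH] t t0.
  rewrite expr0 fact0 divr1; apply: probability_le1.
  by apply: measurable_setle; [exact: measurable_Gsum_RV|exact: measurable_cst].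
rewrite Gsum_cdfS// -pow_sub// [leRHS]integral_mkcond.
under [leRHS]eq_integral do rewrite restrict_EFin.
set g := (_ \_ _).
have g0 x : (0 <= g x)%R.
  rewrite /g patchE; case: ifPn => //; rewrite inE/= in_itv/= => /andP[_ xt].
  by rewrite divr_ge0// exprn_ge0// subr_ge0.
have mg (D : set R) : measurable_fun D (fun x => (g x)%:E).
  apply/measurable_EFinP; apply: measurable_funTS.
  by apply/measurable_restrict => //; apply/measurable_EFinP; exact: mpow.
apply: (@le_trans _ _ (\int[mu]_(x in `[0%R, +oo[) (g x)%:E)%E); last first.
  apply: ge0_subset_integral => //; first exact: mg.
  by move=> x _; rewrite lee_fin.
apply: ge0_le_integral => //.
- by move=> x _; rewrite mule_ge0 ?measure_ge0// lee_fin expR_ge0.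
- exact: mcdf_exp.
- exact: mg.
move=> x; rewrite /= in_itv/= andbT => x0.
have [xt|tx] := leP x t; last first.
  by rewrite Gsum_cdf_lt0 ?subr_lt0// mul0e lee_fin.
rewrite /g patchE ifT; last by rewrite inE/= in_itv/= x0.
rewrite -[leRHS]mule1; apply: lee_pmul.
- exact: measure_ge0.
- by rewrite lee_fin expR_ge0.
- by apply: IH; rewrite subr_ge0.
- by rewrite lee_fin expR_le1 oppr_le0.
Qed.

(** On the same simplex the joint density is at least [e^-t]; the exponentials combine exactly, as
    [e^-(t - x) e^-x = e^-t]. *)
Lemma Gsum_cdf_ge r j (t : R) : (1 <= j)%N -> 0 <= t ->
  ((expR (- t) * (t ^+ r / r`!%:R))%:E <= P [set w | (Gsum T r j w <= t)%R])%E.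
Proof.
move=> j1; elim: r t => [|r IH] t t0.
  rewrite (_ : [set _ | _] = setT) ?probability_setT.
    by rewrite expr0 fact0 divr1 mulr1 lee_fin expR_le1 oppr_le0.
  by apply/seteqP; split => // w _ /=; rewrite /Gsum big_nil.
have pow0 x : `[0%R, t]%classic x -> (0 <= ((t - x) ^+ r / r`!%:R)%:E)%E.
  rewrite /= in_itv/= => /andP[_ xt].
  by rewrite lee_fin divr_ge0// exprn_ge0// subr_ge0.
rewrite Gsum_cdfS// EFinM -pow_sub//.
rewrite -ge0_integralZl_EFin ?expR_ge0//; last exact: mpow.
apply: (@le_trans _ _ (\int[mu]_(x in `[0%R, t])
    (P [set w | (Gsum T r j w <= t - x)%R] * (expR (- x))%:E))%E); last first.
  apply: ge0_subset_integral => //; first exact: mcdf_exp.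
    by move=> x _; rewrite mule_ge0 ?measure_ge0// lee_fin expR_ge0.
  by apply: subset_itvl; rewrite bnd_simp.
apply: ge0_le_integral => //.
- by move=> x xt; rewrite mule_ge0 ?pow0// lee_fin expR_ge0.
- by apply: measurable_funeM; exact: mpow.
- exact: mcdf_exp.
move=> x xt; have := xt; rewrite /= in_itv/= => /andP[x0 xlt].
rewrite -EFinM (_ : expR (- t) * _ =
  expR (- (t - x)) * ((t - x) ^+ r / r`!%:R) * expR (- x)).
  rewrite EFinM lee_wpmul2r ?lee_fin ?expR_ge0//.
  by apply: IH; rewrite subr_ge0.
by rewrite mulrAC -expRD; congr (expR _ * _); ring.
Qed.

Lemma measurable_Gsum_gt r j (t : R) : measurable [set w | t < Gsum T r j w].
Proof. by apply: measurable_setlt; [exact: measurable_cst|exact: measurable_Gsum_RV]. Qed.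

Lemma measurable_Gsum_le r j (t : R) : measurable [set w | Gsum T r j w <= t].
Proof. by apply: measurable_setle; [exact: measurable_Gsum_RV|exact: measurable_cst]. Qed.

Lemma Gsum_survivalE r j (t : R) :
  (P [set w | (t < Gsum T r j w)%R] = 1 - P [set w | (Gsum T r j w <= t)%R])%E.
Proof.
rewrite -probability_setC; last exact: measurable_Gsum_le.
congr (P _); apply/seteqP; split => w /=.
  by move=> h; apply/negP; rewrite -ltNge.
by move/negP; rewrite -ltNge.
Qed.

Definition survival r (t : R) : R := fine (P [set w | t < Gsum T r 1 w]).

Lemma survival_EFin r j (t : R) : (1 <= j)%N ->
  P [set w | t < Gsum T r j w] = (survival r t)%:E.
Proof.
move=> j1; rewrite /survival fineK; last exact: fin_num_measure (measurable_Gsum_gt _ _ _).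
by rewrite !Gsum_survivalE Gsum_cdf_eq.
Qed.

Lemma survival_ge0 r t : 0 <= survival r t.
Proof. by apply: fine_ge0; exact: measure_ge0. Qed.

Lemma survival_le r s t : s <= t -> survival r t <= survival r s.
Proof.
move=> st; rewrite -lee_fin -!(@survival_EFin r 1)//; apply: le_measure.
- by rewrite inE; exact: measurable_Gsum_gt.
- by rewrite inE; exact: measurable_Gsum_gt.
- by move=> w /=; exact: le_lt_trans.
Qed.

Lemma survival_lower r t : 0 <= t -> 1 - t ^+ r / r`!%:R <= survival r t.
Proof.
move=> t0; rewrite -lee_fin -(@survival_EFin r 1)// Gsum_survivalE EFinB.
by apply: leeB => //; exact: Gsum_cdf_le.
Qed.

Lemma survival_upper r t : 0 <= t -> survival r t <= 1 - expR (- t) * t ^+ r / r`!%:R.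
Proof.
move=> t0; rewrite -lee_fin -(@survival_EFin r 1)// Gsum_survivalE EFinB -mulrA.
by apply: leeB => //; exact: Gsum_cdf_ge.
Qed.

Definition survive_cols k a b (x : R) : set Omega :=
  [set w | forall i, (a < i <= b)%N -> x < Gsum T k i w].

Lemma rows_cols k a b i : (a < i <= b)%N -> rows k i `<=` cols a b.
Proof. by move=> ab p [/andP[p1 _] pj]; split => //; rewrite pj. Qed.

Lemma survive_colsS k a b x : (a <= b)%N -> survive_cols k a b.+1 x =
  survive_cols k a b x `&` [set w | x < Gsum T k b.+1 w].
Proof.
move=> ab; apply/seteqP; split => w.
  by move=> h; split => [i /andP[ai ib]|/=]; apply: h; rewrite ?ltnS ?ab ?leqnn// ai leqW.
move=> [h1 h2] i /andP[ai]; rewrite leq_eqVlt => /predU1P[->//|]; rewrite ltnS => ib.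
by apply: h1; rewrite ai.
Qed.

Lemma block_measurable_Gsum_gt D k i (x : R) : rows k i `<=` D ->
  measurable ([set w | x < Gsum T k i w] : set (block X D)).
Proof.
by move=> kD; apply: measurable_setlt; [exact: measurable_cst|exact: measurable_Gsum].
Qed.

Lemma block_measurable_survive_cols k a b (x : R) :
  measurable (survive_cols k a b x : set (block X (cols a b))).
Proof.
rewrite (_ : survive_cols k a b x =
    \bigcap_(i in [set i | (a < i <= b)%N]) [set w | x < Gsum T k i w]) //.
apply: bigcap_measurableType => i /= ab.
by apply: block_measurable_Gsum_gt; exact: rows_cols.
Qed.

Lemma prob_survive_cols k a n (x : R) :
  P (survive_cols k a (a + n) x) = (survival k x ^+ n)%:E.
Proof.
elim: n => [|n IH].
  rewrite addn0 (_ : survive_cols _ _ _ _ = setT) ?probability_setT//.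
  by apply/seteqP; split => // w _ i /andP[ai]; rewrite leqNgt ai.
rewrite addnS survive_colsS ?leq_addr//.
rewrite (indep_block indep (@cols_sub a (a + n)) (@cols_sub (a + n) (a + n).+1)).
- by rewrite IH survival_EFin// -EFinM exprSr.
- by move=> [i j] /= [_ /andP[_ jn]] [_ /andP[nj _]]; rewrite ltnNge jn in nj.
- exact: (@block_measurable_survive_cols k a (a + n) x).
- apply: (@block_measurable_Gsum_gt (cols (a + n) (a + n).+1) k (a + n).+1 x).
  by apply: rows_cols; rewrite ltnSn.
Qed.

(** [T 1 j] is smaller than every [G k i] with [a < i < j]; for [a = 0] this says
that [j] is a one-record. *)
Definition beats k a j : set Omega :=
  [set w | forall i, (a < i < j)%N -> T 1 j w < Gsum T k i w].

(** Conditioning on [T 1 j], which lies outside the [n] compared columns. The value does not involve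
    [a], so a gap counts only through its length; this is what makes convolutions appear. *)
Lemma prob_beats k a n : P (beats k a (a + n).+1) =
  (\int[mu]_(x in `[0%R, +oo[) (expR (- x) * survival k x ^+ n)%:E)%E.
Proof.
pose C : set (R * block X (cols a (a + n))) :=
  [set z | forall i, (a < i <= a + n)%N -> z.1 < Gsum T k i z.2].
have mC : measurable C.
  rewrite (_ : C = \bigcap_(i in [set i | (a < i <= a + n)%N])
     [set z | z.1 < Gsum T k i z.2])//.
  apply: bigcap_measurableType => i /= ab.
  apply: measurable_setlt; first exact: measurable_fst.
  exact: (measurableT_comp (measurable_Gsum (rows_cols (k := k) ab)) measurable_snd).
have -> : beats k a (a + n).+1 = [set w | C (T 1%N (a + n).+1 w, w)].
  by apply/seteqP; split => w; rewrite /beats /C/=.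
rewrite (block_fubini_exp1 (D := cols a (a + n)))//; last 2 first.
- exact: cols_sub.
- by move=> [_] /=; rewrite ltnn andbF.
apply: eq_integral => x _; rewrite mulrC EFinM -(prob_survive_cols k a n).
congr (P _ * _)%E.
by rewrite /xsection /C; apply/seteqP; split => w /=; rewrite inE.
Qed.

Lemma measurable_survival k : measurable_fun setT (survival k).
Proof.
apply/measurable_EFinP.
pose C : set (R * block X (rows k 1)) := [set z | z.1 < Gsum T k 1 z.2].
have mG := @measurable_Gsum (rows k 1) k 1 (fun _ h => h).
have mC : measurable C.
  apply: measurable_setlt; first exact: measurable_fst.
  exact: (measurableT_comp mG measurable_snd).
have := measurable_block_xsection mC; congr measurable_fun.
apply/funext => x; rewrite /= -(@survival_EFin k 1)//; congr (P _).
by rewrite /xsection /C; apply/seteqP; split => w /=; rewrite inE.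
Qed.

End RecordProbabilities.

(** * Convolutions of gap probabilities *)

Section Asymptotics.
Context {R : realType}.
Implicit Types (u v : nat -> R) (a b c e : R).

(** The limit controls all but finitely many indices, the index 0 never being covered. The
    exceptional errors, measured in units of [nbin b], are added up to form [K]; thus [b] may be any
    positive exponent. *)
Lemma nbin_approx u a b c e : 0 < a -> 0 < b -> 0 < e ->
  u n.+1 / nbin a n.+1 @[n --> \oo] --> c ->
  exists2 K, 0 <= K & forall n, `|u n - c * nbin a n| <= e * nbin a n + K * nbin b n.
Proof.
move=> a0 b0 e0 /cvgrPdist_le/(_ e e0)[N _ hN].
pose f i := `|u i - c * nbin a i| / nbin b i.
have f0 i : 0 <= f i by rewrite divr_ge0// ltW// nbin_gt0.
exists (\sum_(i < N.+1) f i); first exact: sumr_ge0.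
move=> n; have an := nbin_gt0 n a0; have bn := nbin_gt0 n b0.
have [nN|Nn] := ltnP n N.+1.
  rewrite -[leLHS]add0r; apply: lerD; first by rewrite mulr_ge0 ?ltW.
  rewrite (bigD1 (Ordinal nN))//= mulrDl -[leLHS]addr0; apply: lerD.
    by rewrite /f divfK// gt_eqF.
  by apply: mulr_ge0; [exact: sumr_ge0|exact: ltW].
rewrite -[leLHS]addr0; apply: lerD; last first.
  by apply: mulr_ge0; [exact: sumr_ge0|exact: ltW].
case: n Nn an {bn} => // n; rewrite ltnS => Nn an.
have -> : u n.+1 - c * nbin a n.+1 = - ((c - u n.+1 / nbin a n.+1) * nbin a n.+1).
  by rewrite mulrBl divfK ?opprB// gt_eqF.
by rewrite normrN normrM (gtr0_norm an) ler_pM2r//; exact: hN.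
Qed.

Definition convolve u v n := \sum_(i < n.+1) v i * u (n - i)%N.

(** This is the convolution of [l + 1] copies of [u]. *)
Definition iter_convolve u l := iter l (convolve u) u.

Lemma iter_convolve_ge0 u l n : (forall n, 0 <= u n) -> 0 <= iter_convolve u l n.
Proof.
move=> u0; elim: l n => [//|l IH] n.
by rewrite /iter_convolve/= /convolve sumr_ge0// => i _; rewrite mulr_ge0//; exact: IH.
Qed.

(** Exponents add under convolution, so the main terms multiply exactly, and every product with an
    error factor loses at least [a / 2] in the exponent. *)
Lemma iter_convolve_le u a D K l : 0 < a -> 0 <= D -> 0 <= K ->
  (forall n, 0 <= u n <= D * nbin a n + K * nbin (a / 2) n) ->
  exists2 K', 0 <= K' & forall n, iter_convolve u l n <=
    D ^+ l.+1 * nbin (a *+ l.+1) n + K' * nbin (a *+ l.+1 - a / 2) n.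
Proof.
move=> a0 D0 K0 hu; elim: l => [|l [K1 K10 IH]].
  exists K => // n; rewrite expr1 mulr1n.
  rewrite (_ : a - a / 2 = a / 2); last lra.
  by case/andP: (hu n).
(* One summand for each product containing an error: the first two have exactly the exponent
   [A + a / 2], the last one has [A] and is raised to it by [nbin_le]. *)
exists (D * K1 + K * D ^+ l.+1 + K * K1).
  by rewrite !addr_ge0 ?mulr_ge0// exprn_ge0.
move=> n; pose v := iter_convolve u l; set A := a *+ l.+1 in IH *.
have A0 : 0 < A - a / 2.
  by rewrite /A mulrS -addrA addrC -addrA ltr_wpDl ?mulrn_wge0 ?(ltW a0)//; lra.
have AS : a *+ l.+2 = A + a by rewrite /A [LHS]mulrSr.
rewrite /iter_convolve iterS -/(iter_convolve u l) /convolve.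
apply: (@le_trans _ _ (\sum_(i < n.+1)
   (D ^+ l.+1 * nbin A i + K1 * nbin (A - a / 2) i) *
   (D * nbin a (n - i) + K * nbin (a / 2) (n - i)))).
  apply: ler_sum => i _; have /andP[u0 u1] := hu (n - i)%N.
  by rewrite ler_pM// iter_convolve_ge0// => m; case/andP: (hu m).
have -> : \sum_(i < n.+1)
   (D ^+ l.+1 * nbin A i + K1 * nbin (A - a / 2) i) *
   (D * nbin a (n - i) + K * nbin (a / 2) (n - i)) =
   D ^+ l.+2 * nbin (A + a) n + (K * D ^+ l.+1) * nbin (A + a / 2) n
   + (D * K1) * nbin (A - a / 2 + a) n + (K * K1) * nbin (A - a / 2 + a / 2) n.
  rewrite -!nbin_conv !mulr_sumr -!big_split /=; apply: eq_bigr => i _.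
  by rewrite (exprS _ l.+1); ring.
rewrite AS; clearbody A.
have -> : A - a / 2 + a = A + a / 2 by lra.
have -> : A + a - a / 2 = A + a / 2 by lra.
rewrite subrK.
have -> : (D * K1 + K * D ^+ l.+1 + K * K1) * nbin (A + a / 2) n =
  K * D ^+ l.+1 * nbin (A + a / 2) n + D * K1 * nbin (A + a / 2) n +
  K * K1 * nbin (A + a / 2) n by ring.
rewrite -[leLHS]addrA -[leLHS]addrA lerD2l addrA lerD2l.
by apply: ler_wpM2l; [exact: mulr_ge0|apply: nbin_le; lra].
Qed.

Lemma sum_iter_convolve_le u a D K l : 0 < a -> 0 <= D -> 0 <= K ->
  (forall n, 0 <= u n <= D * nbin a n + K * nbin (a / 2) n) ->
  exists2 K', 0 <= K' & forall n, \sum_(j < n.+1) iter_convolve u l j <=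
    D ^+ l.+1 * nbin (a *+ l.+1 + 1) n + K' * nbin (a *+ l.+1 + 1 - a / 2) n.
Proof.
move=> a0 D0 K0 hu; have [K1 K10 h] := iter_convolve_le l a0 D0 K0 hu.
exists K1 => // n.
rewrite [X in K1 * nbin X n](_ : _ = a *+ l.+1 - a / 2 + 1); last by ring.
rewrite -!nbin_sum !mulr_sumr -big_split /=.
by apply: ler_sum => i _.
Qed.

Lemma cvg_nbin_lower a b : 0 < b -> b < a ->
  nbin b n / n%:R `^ (a - 1) @[n --> \oo] --> (0 : R).
Proof.
move=> b0 ba; rewrite -(cvg_shiftS (fun n => nbin b n / n%:R `^ (a - 1))).
have := cvg_nbin b0; rewrite -(cvg_shiftS (fun n => nbin b n / n%:R `^ (b - 1))) => h.
have -> : (fun n => nbin b n.+1 / n.+1%:R `^ (a - 1)) =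
    (fun n => nbin b n.+1 / n.+1%:R `^ (b - 1) * n.+1%:R^-1 `^ (a - b)).
  apply/funext => n; rewrite -mulrA; congr (_ * _).
  have n0 : n.+1%:R != 0 :> R by rewrite pnatr_eq0.
  rewrite (_ : a - 1 = (b - 1) + (a - b)); last by ring.
  rewrite powRD ?n0 ?implybT// invfM; congr (_ * _).
  by rewrite -[in RHS]powR_inv1// -powRrM mulN1r powRN.
have ab : 0 < a - b by rewrite subr_gt0.
have h2 : n.+1%:R^-1 `^ (a - b) @[n --> \oo] --> (0 : R).
  have /cvg_at_rightP := powR_cvg0 ab; apply; split; last exact: cvg_harmonic.
  by move=> n; rewrite invr_gt0.
by have := cvgM h h2; rewrite mulr0; apply.
Qed.

End Asymptotics.

(** * The reflection formula and the constants of the theorem *)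

Section Constants.
Context {R : realType}.

(** Gauss' limit at [1 - x] and at [1 + x], where the powers of n cancel, and Euler's formula give
    two limits for the same partial sine products. *)
Lemma Gamma_reflection (x : R) : 0 < x < 1 ->
  Gamma (1 - x) * Gamma (1 + x) = (sin (pi * x) / (pi * x))^-1.
Proof.
move=> x01; have /andP[x0 x1] := x01.
have a0 : 0 < 1 - x by rewrite subr_gt0.
have b0 : 0 < 1 + x by rewrite addr_gt0.
have shift (b : R) : 0 < b ->
    nbin b n.+1 / n.+1%:R `^ (b - 1) @[n --> \oo] --> (Gamma b)^-1.
  by move=> {}b0; rewrite (cvg_shiftS (fun n => nbin b n / n%:R `^ (b - 1))); exact: cvg_nbin.
have h : \prod_(i < n.+1) (1 - x ^+ 2 / i.+1%:R ^+ 2) @[n --> \oo] -->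
    (Gamma (1 - x))^-1 * (Gamma (1 + x))^-1.
  have := cvgM (shift (1 - x) a0) (shift (1 + x) b0).
  have -> : (fun n => nbin (1 - x) n.+1 / n.+1%:R `^ (1 - x - 1)) \*
      (fun n => nbin (1 + x) n.+1 / n.+1%:R `^ (1 + x - 1)) =
      (fun n => \prod_(i < n.+1) (1 - x ^+ 2 / i.+1%:R ^+ 2)).
    apply/funext => n /=.
    rewrite -nbin_reflect.
    have n0 : n.+1%:R != 0 :> R by rewrite pnatr_eq0.
    rewrite mulrACA -invfM -powRD ?n0 ?implybT//.
    by rewrite (_ : 1 - x - 1 + (1 + x - 1) = 0) ?powRr0 ?divr1//; ring.
  by apply.
have := sine_product x01.
rewrite -(cvg_shiftS (fun n => \prod_(i < n) (1 - x ^+ 2 / i.+1%:R ^+ 2))) => h'.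
have := cvg_unique _ h h'; rewrite -invfM => <-//.
by rewrite invrK.
Qed.

(** The base of the [l]-th power in [rho], in the form in which [cvg_record_ratio] produces it as
    the limit ratio of the gap probabilities. *)
Definition gap_const (k : nat) : R :=
  k`!%:R `^ k%:R^-1 * (sin (pi * k%:R^-1) / (pi * k%:R^-1))^-1.

Lemma rhoE k l : (1 < k)%N ->
  rho k l = l`!%:R * gap_const k ^+ l / Gamma ((1 - k%:R^-1) *+ l + 1) :> R.
Proof.
move=> k1; rewrite /rho mulrAC; congr (_ * _ / Gamma _).
  congr (_ ^+ _); rewrite /gap_const div1r invf_div.
  have k0 : k%:R != 0 :> R by rewrite pnatr_eq0 -lt0n ltnW.
  by rewrite invfM; ring.
by rewrite mulrnBl -[k%:R^-1 *+ l]mulr_natl; ring.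
Qed.

(** Reflection turns the sine into [Gamma (1 - 1/k) * Gamma (1 + 1/k)]. The functional equation
    cancels the first factor against the denominator of [rho], leaving [1 - 1/k] below and
    [Gamma (1/k) / k] above. *)
Lemma rho1_eta1 k : (1 < k)%N -> rho k 1 = eta1 k :> R.
Proof.
move=> k1; rewrite rhoE// expr1 mulr1n mul1r /gap_const /eta1 !div1r.
have k0 : k%:R != 0 :> R by rewrite pnatr_eq0 -lt0n ltnW.
have k10 : k%:R - 1 != 0 :> R by rewrite subr_eq0 pnatr_eq1 gtn_eqF.
have x01 : 0 < (k%:R^-1 : R) < 1.
  by rewrite invr_gt0 invf_lt1 ?ltr0n ?ltr1n ?k1 ?andbT// ltnW.
have /andP[x0 x1] := x01.
rewrite -Gamma_reflection// (addrC 1 k%:R^-1).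
have a0 : 0 < 1 - k%:R^-1 :> R by rewrite subr_gt0.
have g0 := lt0r_neq0 (Gamma_gt0 a0).
rewrite !GammaD1//.
move: (Gamma (1 - _)) g0 (Gamma k%:R^-1) (k`!%:R `^ _) => g g0 h s.
move: (k%:R : R) k0 k10 => r r0 r1; field.
by rewrite r0 r1 g0.
Qed.

Lemma gap_const_gt0 k : (1 < k)%N -> 0 < gap_const k.
Proof.
move=> k1.
have x0 : 0 < (k%:R^-1 : R) by rewrite invr_gt0 ltr0n ltnW.
have x1 : (k%:R^-1 : R) < 1 by rewrite invf_lt1 ?ltr0n ?ltr1n// ltnW.
rewrite mulr_gt0 ?powR_gt0 ?ltr0n ?fact_gt0// invr_gt0 divr_gt0 ?mulr_gt0 ?pi_gt0//.
rewrite sin_gt0_pi// mulr_gt0 ?pi_gt0//=.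
by rewrite gtr_pMr ?pi_gt0.
Qed.

End Constants.

(** * Moments of the number of one-records *)

Section Chains.
Context {R : realType} (ind : nat -> R).
Hypothesis record_ind01 : forall j, ind j = 0 \/ ind j = 1.

(** The sum over weakly increasing [j_1 <= ... <= j_l <= n] of the products of
the [ind j_m]; allowing equalities makes it dominate the power with no
lower-order terms. *)
Fixpoint chain_sum l n : R :=
  if l is l'.+1 then \sum_(1 <= j < n.+1) ind j * chain_sum l' j else 1.

Let ind_ge0 j : 0 <= ind j. Proof. by case: (record_ind01 j) => ->. Qed.

Lemma chain_sum_ge0 l n : 0 <= chain_sum l n.
Proof.
elim: l n => [//|l IH] n /=; apply: sumr_ge0 => j _; exact: mulr_ge0.
Qed.

(** A discrete form of integrating [(l + 1) s^l]: when the partial sum jumps from [s] to [s + 1],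
    its power grows by at most [(l + 1) (s + 1)^l], and the inner sum includes [j] itself, hence
    takes the value after the jump. *)
Let exprS_sum n l : (\sum_(1 <= j < n.+1) ind j) ^+ l.+1 <=
  l.+1%:R * \sum_(1 <= j < n.+1) ind j * (\sum_(1 <= i < j.+1) ind i) ^+ l.
Proof.
elim: n => [|n IH]; first by rewrite !big_nil expr0n/= mulr0.
rewrite [in leRHS]big_nat_recr//= mulrDr.
rewrite big_nat_recr//=; set s := \sum_(1 <= j < n.+1) ind j in IH *.
have s0 : 0 <= s by exact: sumr_ge0.
apply: (le_trans _ (lerD IH (lexx _))).
case: (record_ind01 n.+1) => ->; first by rewrite addr0 mul0r mulr0 addr0.
rewrite mul1r -lerBlDl subrXX addrAC subrr add0r mul1r.
apply: (@le_trans _ _ (\sum_(i < l.+1) (s + 1) ^+ l)); last first.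
  by rewrite sumr_const card_ord mulr_natl.
apply: ler_sum => i _ /=.
have il : (i <= l)%N by rewrite -ltnS.
rewrite -[in leRHS](subnK il) exprD.
rewrite ler_wpM2l ?exprn_ge0 ?addr_ge0// lerXn2r ?nnegrE ?addr_ge0//.
by rewrite lerDl.
Qed.

Lemma exprn_le_chain_sum l n :
  (\sum_(1 <= j < n.+1) ind j) ^+ l <= l`!%:R * chain_sum l n.
Proof.
elim: l n => [|l IH] n; first by rewrite expr0 fact0 mulr1.
apply: (le_trans (exprS_sum n l)).
rewrite factS natrM -mulrA ler_wpM2l//= mulr_sumr; apply: ler_sum => j _.
by rewrite mulrCA ler_wpM2l.
Qed.

End Chains.

Section Moments.
Context {R : realType} {d : measure_display} {Omega : measurableType d}.
Context (P : probability Omega R) (T : nat -> nat -> {RV P >-> R}).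
Hypothesis hT : iid_exp1 T.
Context (k : nat).

Let D0 : set (nat * nat) := [set p | (1 <= p.1)%N /\ (1 <= p.2)%N].
Let X (p : nat * nat) := T p.1 p.2.
Let indep : mutually_independent D0 X. Proof. exact: hT.2. Qed.

Lemma record_indicatorE j w : (1 <= j)%N ->
  record_indicator T k 1 j w = \1_(beats T k 0 j) w.
Proof.
move=> j1; rewrite /record_indicator indicE; congr ((nat_of_bool _)%:R).
have G1 : Gsum T 1 j w = T 1 j w by rewrite /Gsum big_nat1.
rewrite /is_record G1; apply/idP/idP.
  move=> h; rewrite inE /beats/= => i /andP[i1 ij].
  rewrite -lte_fin; apply: lt_le_trans h _; apply: ge_bigmin_seq => //.
  by rewrite mem_index_iota i1.
rewrite inE => h; rewrite big_nat_cond; apply: lt_bigmin => [|i]; first exact: ltry.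
by rewrite andbT lte_fin => ij; apply: h; case/andP: ij => -> ->.
Qed.

Lemma block_measurable_beats a j : (a < j)%N ->
  measurable (beats T k a j : set (block X (cols a j))).
Proof.
move=> aj.
rewrite (_ : beats T k a j =
    \bigcap_(i in [set i | (a < i < j)%N]) [set w | T 1 j w < Gsum T k i w]) //.
apply: bigcap_measurableType => i /= /andP[ai ij].
apply: measurable_setlt.
  by apply: (@measurable_block _ _ _ _ _ X _ (1, j)%N); split => //=; rewrite aj leqnn.
by apply: measurable_Gsum; apply: rows_cols; rewrite ai ltnW.
Qed.

Lemma measurable_beats a j : measurable (beats T k a j).
Proof.
have [aj|ja] := ltnP a j; first exact: block_measurable (block_measurable_beats aj).
rewrite (_ : beats T k a j = setT)//; apply/seteqP; split => // w _ i /andP[ai ij].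
by have := leq_trans ij ja; rewrite leqNgt ltnS ltnW.
Qed.

(** [record_prob 0 = 1], the event being vacuous: this is the weight of the gap
between two equal indices. *)
Definition record_prob n : R := fine (P (beats T k 0 n)).

Lemma record_prob_ge0 n : 0 <= record_prob n.
Proof. by apply: fine_ge0; exact: measure_ge0. Qed.

Lemma record_prob0 : record_prob 0 = 1.
Proof.
rewrite /record_prob (_ : beats T k 0 0 = setT) ?probability_setT//.
by apply/seteqP; split => // w _ i; rewrite ltn0 andbF.
Qed.

Lemma prob_beatsE a j : (a < j)%N -> P (beats T k a j) = (record_prob (j - a))%:E.
Proof.
move=> aj; rewrite /record_prob fineK; last first.
  by apply: fin_num_measure; exact: measurable_beats.
have [n jE] : exists n, j = (a + n).+1 by exists (j - a).-1; lia.
have -> : (j - a)%N = (0 + n).+1 by lia.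
by rewrite jE !(prob_beats hT).
Qed.

Definition rec_ind j w : R := \1_(beats T k 0 j) w.

Lemma rec_ind01 w j : rec_ind j w = 0 \/ rec_ind j w = 1.
Proof. by rewrite /rec_ind indicE; case: (_ \in _); [right|left]. Qed.

Let h l j w : R := chain_sum (rec_ind ^~ w) l j.

Let h_ge0 l j w : 0 <= h l j w.
Proof. exact/chain_sum_ge0/rec_ind01. Qed.

Let ind_ge0 j w : 0 <= rec_ind j w.
Proof. by rewrite /rec_ind indicE. Qed.

Lemma cols_mono a b a' b' : (a' <= a)%N -> (b <= b')%N -> cols a b `<=` cols a' b'.
Proof.
move=> aa bb [i j] /= [i1 /andP[aj jb]]; split => //=.
by rewrite (leq_ltn_trans aa aj) (leq_trans jb bb).
Qed.

Lemma block_measurable_ind n j : (0 < j <= n)%N ->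
  measurable_fun [set: block X (cols 0 n)] (rec_ind j : block X (cols 0 n) -> R).
Proof.
move=> /andP[j0 jn]; apply: measurable_indic.
exact: (sub_block (cols_mono (leqnn 0) jn)) (block_measurable_beats j0).
Qed.

Lemma block_measurable_chain n l j : (j <= n)%N ->
  measurable_fun [set: block X (cols 0 n)] (h l j : block X (cols 0 n) -> R).
Proof.
elim: l j => [|l IH] j jn; first exact: measurable_cst.
rewrite /h/=; under eq_fun do rewrite big_nat_cond.
apply: measurable_sum_cond => i; rewrite andbT ltnS => /andP[i1 ij].
have ijn := leq_trans ij jn.
by apply: measurable_funM; [apply: block_measurable_ind; rewrite i1|exact: IH].
Qed.

Lemma measurable_ind j : measurable_fun [set: Omega] (rec_ind j).
Proof. by apply: measurable_indic; exact: measurable_beats. Qed.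

Lemma measurable_chain l j : measurable_fun [set: Omega] (h l j).
Proof.
exact: (measurableT_comp (block_measurable_chain l (leqnn j))
  (@measurable_block_id _ _ _ _ _ X _)).
Qed.

Lemma integral_ind j : (0 < j)%N -> (\int[P]_w (rec_ind j w)%:E = (record_prob j)%:E)%E.
Proof.
move=> j0; rewrite integral_indic//; last exact: measurable_beats.
by rewrite setIT; have := prob_beatsE j0; rewrite subn0.
Qed.

(** For an inner index [i < j], the record condition at [j] is weakened to [beats T k i j]. This
    event depends on [cols i j] only, whereas the indicator at [i] and its chain depend on
    [cols 0 i]; independence gives one more convolution factor. *)
Lemma integral_record_chain l j : (0 < j)%N ->
  (\int[P]_w (rec_ind j w * h l j w)%:E <= (iter_convolve record_prob l j)%:E)%E.
Proof.
elim: l j => [|l IH] j j0.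
  rewrite /h/=; under eq_integral do rewrite mulr1.
  by rewrite integral_ind.
pose g i w : R := rec_ind i w * h l i w.
have g0 i w : 0 <= g i w by exact: mulr_ge0.
have mg i : measurable_fun [set: Omega] (g i).
  by apply: measurable_funM; [exact: measurable_ind|exact: measurable_chain].
have mgb i : measurable_fun [set: Omega] (fun w => (g i w * \1_(beats T k i j) w)%:E).
  apply/measurable_EFinP; apply: measurable_funM => //.
  by apply: measurable_indic; exact: measurable_beats.
apply: (@le_trans _ _ (\int[P]_w ((g j w)%:E +
    \sum_(1 <= i < j) (g i w * \1_(beats T k i j) w)%:E))%E).
  apply: ge0_le_integral => //.
  - by move=> w _; rewrite lee_fin mulr_ge0.
  - apply/measurable_EFinP; apply: measurable_funM; first exact: measurable_ind.
    exact: measurable_chain.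
  - apply: emeasurable_funD; first exact/measurable_EFinP/mg.
    by apply: emeasurable_sum => i; exact: mgb.
  move=> w _; rewrite sumEFin -EFinD lee_fin.
  (* In the term [i = j], one of the two equal indicators is bounded by 1: a gap of length 0 with
     weight 1. *)
  rewrite [h _ _ _]/= big_nat_recr//= mulrDr addrC lerD//.
    by apply: ler_piMl; [exact: g0|rewrite /rec_ind indicE; case: (_ \in _)].
  rewrite mulr_sumr [leLHS]big_nat_cond [leRHS]big_nat_cond.
  apply: ler_sum => i; rewrite andbT => /andP[i1 ij].
  rewrite mulrC; apply: ler_wpM2l; first exact: g0.
  rewrite /rec_ind !indicE.
  case: (boolP (w \in beats T k 0 j)) => [|_]; last exact: ler0n.
  rewrite inE => wj; rewrite mem_set// => i' /andP[ii' i'j]; apply: wj.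
  by rewrite i'j andbT (leq_ltn_trans _ ii').
have gb0 i w : (0 <= (g i w * \1_(beats T k i j) w)%:E)%E.
  by rewrite lee_fin mulr_ge0.
rewrite ge0_integralD//; last 4 first.
- by move=> w _; rewrite lee_fin.
- exact/measurable_EFinP/mg.
- by move=> w _; apply: sume_ge0 => i _; exact: gb0.
- by apply: emeasurable_sum => i; exact: mgb.
rewrite ge0_integral_sum//.
have step i : (1 <= i < j)%N ->
    (\int[P]_w (g i w * \1_(beats T k i j) w)%:E <=
     (iter_convolve record_prob l i * record_prob (j - i))%:E)%E.
  move=> /andP[i1 ij].
  under eq_integral do rewrite EFinM.
  rewrite (indep_block_integral indep (D1 := cols 0 i) (D2 := cols i j)) //.
  - rewrite prob_beatsE// muleC EFinM lee_wpmul2r ?lee_fin ?record_prob_ge0//.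
    exact: IH.
  - exact: cols_sub.
  - exact: cols_sub.
  - by move=> [a b] /= [_ /andP[_ bi]] [_ /andP[ib _]]; rewrite ltnNge bi in ib.
  - apply/measurable_EFinP; apply: measurable_funM.
      by apply: block_measurable_ind; rewrite i1 leqnn.
    exact: block_measurable_chain.
  - by move=> w; rewrite lee_fin.
  - exact: block_measurable_beats.
rewrite /iter_convolve iterS -/(iter_convolve record_prob l) /convolve.
rewrite -(big_mkord xpredT (fun i => iter_convolve record_prob l i * record_prob (j - i))).
rewrite big_nat_recr//= subnn record_prob0 mulr1 addrC EFinD.
apply: leeD; first exact: IH.
(* The convolution has a further term at index 0, where no chain index lies; it is nonnegative and
   dropped. *)
rewrite [in leRHS]big_ltn// EFinD -[leLHS]add0e; apply: leeD.
  by rewrite lee_fin mulr_ge0 ?record_prob_ge0// iter_convolve_ge0//; exact: record_prob_ge0.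
rewrite -sumEFin [leLHS]big_nat_cond [leRHS]big_nat_cond.
by apply: lee_sum => i; rewrite andbT; exact: step.
Qed.

End Moments.

(** * Limits of the normalized moments *)

Section MomentLimits.
Context {R : realType} {d : measure_display} {Omega : measurableType d}.
Context (P : probability Omega R) (T : nat -> nat -> {RV P >-> R}).
Hypothesis hT : iid_exp1 T.
Context (k : nat) (k1 : (1 < k)%N).

Let x : R := k%:R^-1.
Let a : R := 1 - x.
Let rp := record_prob T k.

Let x0 : 0 < x. Proof. by rewrite invr_gt0 ltr0n ltnW. Qed.
Let x1 : x < 1. Proof. by rewrite invf_lt1 ?ltr0n ?ltr1n// ltnW. Qed.
Let a0 : 0 < a. Proof. by rewrite subr_gt0. Qed.

Lemma one_recordsE n w : one_records T k n w = \sum_(1 <= j < n.+1) rec_ind T k j w.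
Proof.
by apply: eq_big_nat => j /andP[j1 _]; rewrite record_indicatorE.
Qed.

Lemma expectation_one_records n :
  ('E_P[one_records T k n] = (\sum_(1 <= j < n.+1) rp j)%:E)%E.
Proof.
rewrite unlock.
under eq_integral do rewrite one_recordsE -sumEFin.
rewrite ge0_integral_sum//; last 2 first.
- by move=> i; apply/measurable_EFinP; exact: measurable_ind.
- by move=> i w _; rewrite lee_fin /rec_ind indicE.
rewrite -sumEFin; apply: eq_big_nat => j /andP[j1 _].
exact: integral_ind.
Qed.

Lemma cvg_record_prob_ratio : rp n.+1 / nbin a n.+1 @[n --> \oo] --> gap_const k.
Proof.
apply: (@cvg_record_ratio R k (survival T k) rp) => //.
- exact: ltnW.
- exact: measurable_survival.
- exact: survival_ge0.
- exact: survival_le.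
- exact: survival_lower.
- exact: survival_upper.
- move=> g; rewrite -(prob_beats hT k 0 g) add0n.
  by rewrite (prob_beatsE hT)// subn0.
Qed.

Lemma moment_le_chain l n : (one_records_moment T k l.+1 n <=
  (l.+1`!%:R / (n%:R `^ (1 - 1 / k%:R)) ^+ l.+1 *
   \sum_(j < n.+1) iter_convolve rp l j)%:E)%E.
Proof.
set c := _ / _.
have c0 : 0 <= c by rewrite divr_ge0// exprn_ge0// powR_ge0.
rewrite /one_records_moment unlock.
have i01 w := rec_ind01 T k w.
have chain_ge0 w j : 0 <= chain_sum (rec_ind T k ^~ w) l j by exact: chain_sum_ge0.
have mterm j : measurable_fun [set: Omega]
    (fun w => rec_ind T k j w * chain_sum (rec_ind T k ^~ w) l j).
  by apply: measurable_funM; [exact: measurable_ind|exact: measurable_chain].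
have mchain : measurable_fun [set: Omega]
    (fun w => \sum_(1 <= j < n.+1) rec_ind T k j w * chain_sum (rec_ind T k ^~ w) l j).
  by apply: measurable_sum => j; exact: mterm.
apply: (@le_trans _ _ (\int[P]_w (c%:E *
    (\sum_(1 <= j < n.+1) rec_ind T k j w * chain_sum (rec_ind T k ^~ w) l j)%:E))%E).
  apply: ge0_le_integral => //.
  - move=> w _; rewrite lee_fin exprn_ge0// divr_ge0 ?powR_ge0//.
    by rewrite one_recordsE sumr_ge0// => j _; rewrite /rec_ind indicE.
  - apply/measurable_EFinP; apply: measurable_funX; apply: measurable_funM => //.
    rewrite (_ : one_records T k n = (fun w => \sum_(1 <= j < n.+1) rec_ind T k j w)).
      by apply: measurable_sum => j; exact: measurable_ind.
    by apply/funext => w; rewrite one_recordsE.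
  - by apply: measurable_funeM; apply/measurable_EFinP; exact: mchain.
  move=> w _; rewrite -EFinM lee_fin expr_div_n /c -mulrA (mulrC _^-1) mulrA.
  rewrite ler_wpM2r ?invr_ge0 ?exprn_ge0 ?powR_ge0//.
  rewrite one_recordsE; exact: (exprn_le_chain_sum (i01 w) l.+1 n).
rewrite ge0_integralZl_EFin//; last 2 first.
- by move=> w _; rewrite lee_fin sumr_ge0// => j _; rewrite mulr_ge0 ?chain_ge0// /rec_ind indicE.
- by apply/measurable_EFinP; exact: mchain.
rewrite [leRHS]EFinM; apply: lee_wpmul2l; first by rewrite lee_fin.
under eq_integral do rewrite -sumEFin.
rewrite ge0_integral_sum//; last 2 first.
- by move=> j; apply/measurable_EFinP; exact: mterm.
- by move=> j w _; rewrite lee_fin mulr_ge0 ?chain_ge0// /rec_ind indicE.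
(* Chain indices start at 1; the nonnegative term at 0 is added to match the partial sums of the
   coefficients. *)
rewrite -(big_mkord xpredT (fun j => iter_convolve rp l j)) big_ltn// EFinD -[leLHS]add0e.
apply: leeD; first by rewrite lee_fin iter_convolve_ge0// => j; exact: record_prob_ge0.
rewrite -sumEFin [leLHS]big_nat_cond [leRHS]big_nat_cond.
by apply: lee_sum => j; rewrite andbT => /andP[j1 _]; exact: integral_record_chain.
Qed.

Let apow n l : (n%:R `^ (1 - 1 / k%:R)) ^+ l = n%:R `^ ((a *+ l + 1) - 1) :> R.
Proof.
by rewrite addrK div1r -/x -/a -powR_mulrn ?powR_ge0// -powRrM mulr_natr.
Qed.

(** For fixed [e] the gap probabilities are dominated with the constant [C + e]; after normalization
    the lower-order term vanishes. Then [e] tends to 0 along [1 / (n + 1)]. *)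
Lemma limn_esup_moment_le l : (0 < l)%N ->
  (limn_esup (one_records_moment T k l) <= (rho k l)%:E)%E.
Proof.
case: l => // l _; rewrite rhoE// -/x -/a.
set C := gap_const k.
have C0 : 0 < C by exact: gap_const_gt0.
set A := a *+ l.+1 + 1.
have al0 : 0 < a *+ l.+1 by rewrite mulrn_wgt0.
have aal : a <= a *+ l.+1 by rewrite mulrS lerDl mulrn_wge0// ltW.
have A0 : 0 < A by rewrite /A addr_gt0.
have bound e : 0 < e -> (limn_esup (one_records_moment T k l.+1) <=
    (l.+1`!%:R * (C + e) ^+ l.+1 / Gamma A)%:E)%E.
  move=> e0.
  have a20 : 0 < a / 2 by rewrite divr_gt0.
  have [K K0 hK] := nbin_approx a0 a20 e0 cvg_record_prob_ratio.
  have hu n : 0 <= rp n <= (C + e) * nbin a n + K * nbin (a / 2) n.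
    rewrite record_prob_ge0/= mulrDl -addrA -lerBlDl.
    exact: (ler_normlW (hK n)).
  have Ce : 0 <= C + e by rewrite addr_ge0 ?ltW.
  have [K1 K10 h] := sum_iter_convolve_le l a0 Ce K0 hu.
  pose v n : R := l.+1`!%:R * (C + e) ^+ l.+1 * (nbin A n / n%:R `^ (A - 1)) +
     l.+1`!%:R * K1 * (nbin (A - a / 2) n / n%:R `^ (A - 1)).
  have cv : v n @[n --> \oo] --> l.+1`!%:R * (C + e) ^+ l.+1 / Gamma A.
    rewrite -[X in _ --> X]addr0 -[X in _ + X](mulr0 (l.+1`!%:R * K1)).
    apply: cvgD; (apply: cvgM; first exact: cvg_cst).
      exact: cvg_nbin.
    apply: cvg_nbin_lower; last by rewrite ltrBlDr ltrDl.
    by rewrite /A; lra.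
  have cve : (v n)%:E @[n --> \oo] --> (l.+1`!%:R * (C + e) ^+ l.+1 / Gamma A)%:E.
    by apply: cvg_EFin => //; exact: nearW.
  have le_v n : (one_records_moment T k l.+1 n <= (v n)%:E)%E.
    apply: (le_trans (moment_le_chain l n)); rewrite lee_fin apow -/A.
    rewrite /v !mulrA -mulrDl mulrAC ler_wpM2r ?invr_ge0 ?powR_ge0//.
    rewrite -!mulrA -mulrDr ler_wpM2l//.
  rewrite limn_esup_lim -(cvg_lim _ (cvg_esups cve))//.
  apply: lee_lim; [exact: is_cvg_esups|exact: is_cvg_esups|].
  apply: nearW => n; apply: ub_ereal_sup => _ [i ni <-].
  by apply: (le_trans (le_v i)); apply: ereal_sup_ubound; exists i.
have cF : l.+1`!%:R * (C + n.+1%:R^-1) ^+ l.+1 / Gamma A @[n --> \oo] -->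
    l.+1`!%:R * C ^+ l.+1 / Gamma A.
  apply: cvgM; last exact: cvg_cst.
  apply: cvgM; first exact: cvg_cst.
  have hC : C + n.+1%:R^-1 @[n --> \oo] --> C.
    rewrite -[X in _ --> X]addr0; apply: cvgD; first exact: cvg_cst.
    exact: cvg_harmonic.
  exact: (@cvg_comp _ _ _ (fun n => C + n.+1%:R^-1) (fun y : R => y ^+ l.+1) _ _ _ hC
    (@exprn_continuous R l.+1 C)).
have cFe : (l.+1`!%:R * (C + n.+1%:R^-1) ^+ l.+1 / Gamma A)%:E @[n --> \oo] -->
    (l.+1`!%:R * C ^+ l.+1 / Gamma A)%:E.
  by apply: cvg_EFin => //; exact: nearW.
rewrite -(cvg_lim _ cFe)//; apply: lime_ge.
  by apply/cvg_ex; eexists; exact: cFe.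
by apply: nearW => n; apply: bound; rewrite invr_gt0.
Qed.

(** For one index the mean is exactly a sum of gap probabilities, so the two-sided estimate of
    [nbin_approx] gives a limit and not only an upper bound. *)
Lemma cvg_expectation :
  (\sum_(1 <= j < n.+1) rp j) / n%:R `^ a @[n --> \oo] --> (rho k 1 : R).
Proof.
rewrite rhoE// -/x -/a mul1r expr1 mulr1n.
set C := gap_const k; set G := (Gamma (a + 1))^-1.
have G0 : 0 < G by rewrite invr_gt0 Gamma_gt0// addr_gt0.
have a10 : 0 < a + 1 by rewrite addr_gt0.
have a20 : 0 < a / 2 by rewrite divr_gt0.
have cG : nbin (a + 1) n / n%:R `^ a @[n --> \oo] --> G.
  by have := cvg_nbin a10; rewrite addrK.
have lower b : 0 < b -> b < a + 1 -> nbin b n / n%:R `^ a @[n --> \oo] --> (0 : R).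
  by move=> b0 ba; have := cvg_nbin_lower b0 ba; rewrite addrK.
pose S n := \sum_(1 <= j < n.+1) rp j.
have t0 : S n / n%:R `^ a - C * (nbin (a + 1) n / n%:R `^ a) @[n --> \oo] --> (0 : R).
  apply/cvgrPdist_le => e e0.
  (* Eventually [G + 1] bounds the normalized main coefficient, so this tolerance contributes at
     most [e / 2]. *)
  have e1 : 0 < e / (2 * (G + 1)) by rewrite divr_gt0// mulr_gt0// addr_gt0.
  have [K K0 hK] := nbin_approx a0 a20 e1 cvg_record_prob_ratio.
  (* The mean sums from index 1, the coefficients from 0. The excess [rp 0 = 1] is written
     [nbin 1 n], so that [lower] makes it negligible as well. *)
  have r0 : K * (nbin (a / 2 + 1) n / n%:R `^ a) + nbin 1 n / n%:R `^ a
      @[n --> \oo] --> K * 0 + 0.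
    apply: cvgD; last by apply: lower; rewrite ?ltrDr.
    apply: cvgM; first exact: cvg_cst.
    apply: lower; first by rewrite addr_gt0.
    by rewrite ltrD2r ltr_pdivrMr// ltr_pMr// ltr1n.
  rewrite mulr0 addr0 in r0.
  move/cvgrPdist_le : cG => /(_ 1 ltr01) cG.
  have e20 : 0 < e / 2 by rewrite divr_gt0.
  move/cvgrPdist_le : r0 => /(_ _ e20) r0.
  near=> n.
  have h1 : nbin (a + 1) n / n%:R `^ a <= G + 1.
    have : `|G - nbin (a + 1) n / n%:R `^ a| <= 1 by near: n.
    by rewrite ler_norml => /andP[]; lra.
  have h2 : K * (nbin (a / 2 + 1) n / n%:R `^ a) + nbin 1 n / n%:R `^ a <= e / 2.
    have : `|0 - (K * (nbin (a / 2 + 1) n / n%:R `^ a) + nbin 1 n / n%:R `^ a)| <= e / 2.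
      by near: n.
    by rewrite sub0r normrN; exact: ler_normlW.
  have h3 : `|S n - C * nbin (a + 1) n| <=
      e / (2 * (G + 1)) * nbin (a + 1) n + K * nbin (a / 2 + 1) n + nbin 1 n.
    rewrite nbin1 -!nbin_sum !mulr_sumr -big_split/=.
    have -> : S n = \sum_(i < n.+1) rp i - 1.
      rewrite -(big_mkord xpredT rp) big_ltn// /rp record_prob0.
      by rewrite addrAC subrr add0r.
    rewrite addrAC; apply: (le_trans (ler_normB _ _)); rewrite normr1 lerD2r.
    rewrite -sumrB; apply: (le_trans (ler_norm_sum _ _ _)).
    by apply: ler_sum => i _; exact: hK.
  rewrite sub0r normrN mulrA -mulrBl normrM.
  have p0 : 0 <= (n%:R `^ a)^-1 by rewrite invr_ge0 powR_ge0.
  rewrite (ger0_norm p0).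
  apply: (le_trans (ler_wpM2r p0 h3)).
  have h4 : e / (2 * (G + 1)) * (nbin (a + 1) n / n%:R `^ a) <= e / (2 * (G + 1)) * (G + 1).
    by rewrite ler_wpM2l// ltW.
  have h5 : e / (2 * (G + 1)) * (G + 1) = e / 2.
    by field; rewrite gt_eqF// addr_gt0.
  rewrite h5 in h4.
  rewrite 2!mulrDl -!(mulrA _ _ (n%:R `^ a)^-1) -addrA.
  by apply: le_trans (lerD h4 h2) _; lra.
have -> : (fun n => (\sum_(1 <= j < n.+1) rp j) / n%:R `^ a) =
   (fun n => S n / n%:R `^ a - C * (nbin (a + 1) n / n%:R `^ a) +
     C * (nbin (a + 1) n / n%:R `^ a)).
  by apply/funext => n; rewrite subrK.
have := cvgD t0 (cvgM (@cvg_cst _ C _ \oo _) cG).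
by rewrite add0r; apply.
Unshelve. all: by end_near. Qed.

Lemma first_momentE n : one_records_moment T k 1 n =
  ((\sum_(1 <= j < n.+1) rp j) / n%:R `^ a)%:E.
Proof.
have := expectation_one_records n; rewrite /one_records_moment unlock => e.
transitivity ((n%:R `^ a)^-1%:E * \int[P]_w (one_records T k n w)%:E)%E; last first.
  by rewrite e mulrC EFinM.
rewrite -ge0_integralZl_EFin//.
- by apply: eq_integral => w _; rewrite -EFinM expr1 mulrC div1r.
- by move=> w _; rewrite lee_fin one_recordsE sumr_ge0// => j _; rewrite /rec_ind indicE.
- apply/measurable_EFinP.
  rewrite (_ : one_records T k n = (fun w => \sum_(1 <= j < n.+1) rec_ind T k j w)).
    by apply: measurable_sum => j; exact: measurable_ind.
  by apply/funext => w; rewrite one_recordsE.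
Qed.

End MomentLimits.

Theorem theorem3 (R : realType) (d : measure_display)
    (Omega : measurableType d) (P : probability Omega R)
    (T : nat -> nat -> {RV P >-> R}) (hT : iid_exp1 T)
    (k : nat) (hk : (2 <= k)%N) :
  [/\ (forall l : nat, (1 <= l)%N ->
         (limn_esup (one_records_moment T k l) <= (rho k l)%:E)%E),
      limn_esup (one_records_moment T k 1) = (rho k 1)%:E,
      rho k 1 = eta1 k :> R &
      (fun n : nat => fine ('E_P[one_records T k n])%E : R)
        ~_\oo (fun n : nat => eta1 k * n%:R `^ (1 - 1 / k%:R) : R)].
Proof.
have cE := cvg_expectation hT hk.
split.
- by move=> l l1; exact: limn_esup_moment_le.
- have -> : one_records_moment T k 1 = (fun n =>
      ((\sum_(1 <= j < n.+1) record_prob T k j) / n%:R `^ (1 - k%:R^-1))%:E).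
    by apply/funext => n; exact: first_momentE.
  have cEe : ((\sum_(1 <= j < n.+1) record_prob T k j) / n%:R `^ (1 - k%:R^-1))%:E
      @[n --> \oo] --> (rho k 1 : R)%:E.
    by apply: cvg_EFin => //; exact: nearW.
  rewrite is_cvg_limn_esupE; last by apply/cvg_ex; eexists; exact: cEe.
  exact: cvg_lim cEe.
- exact: rho1_eta1.
- apply/eqaddoP => e e0.
  rewrite -rho1_eta1// div1r.
  have r0 : 0 < (rho k 1 : R).
    have x1 : (k%:R^-1 : R) < 1 by rewrite invf_lt1 ?ltr0n ?ltr1n// ltnW.
    rewrite rhoE// expr1 !mulr1n mul1r divr_gt0 ?gap_const_gt0// Gamma_gt0//.
    by rewrite addr_gt0// subr_gt0.
  (* The error must be small relative to [rho k 1] times the power of n, hence the tolerance scaled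
     by this constant. *)
  have er0 : 0 < e * rho k 1 by rewrite mulr_gt0.
  move/cvgrPdist_le : cE => /(_ _ er0) cE.
  near=> n.
  have n0 : 0 < n%:R `^ (1 - k%:R^-1) :> R.
    by rewrite powR_gt0// ltr0n; near: n; exact: nbhs_infty_gt.
  have -> : ((fun n => fine ('E_P[one_records T k n])%E) -
      (fun n => rho k 1 * n%:R `^ (1 - k%:R^-1))) n =
      - ((rho k 1 - (\sum_(1 <= j < n.+1) record_prob T k j) / n%:R `^ (1 - k%:R^-1)) *
         n%:R `^ (1 - k%:R^-1)) :> R.
    rewrite mulrBl divfK ?gt_eqF// opprB.
    by rewrite -[LHS]/(fine _ - _) expectation_one_records.
  rewrite normrN normrM (gtr0_norm n0) [X in _ <= _ * X]gtr0_norm; last exact: mulr_gt0.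
  rewrite mulrA ler_pM2r//.
  by near: n.
Unshelve. all: by end_near. Qed.
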